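(* Let $Q(y|x)$ be an irreducible transition matrix on $\mathbb Z_d=\{0,\dots,d-1\}$, let $s_0\in\mathbb Z_d$ be an initial state, and consider the additive Markovian channel $W(Q)^n$. Assume $V(Q)>0$. Then for every real $a$ and every $0<\epsilon<1$, \[ C_p^{\mathrm{AM}}(a\mid Q)=G\big(a/\sqrt{V(Q)}\big),\qquad C^{\mathrm{AM}}(\epsilon\mid Q)=\sqrt{V(Q)}\,G^{-1}(\epsilon). \]
   Context: Arithmetic is mod $d$. For $x,y\in\mathbb Z_d^n$, $W(Q)^n(y|x)=\prod_{i=1}^nQ(y_i-x_i\mid y_{i-1}-x_{i-1})$ with $y_0-x_0:=s_0$; equivalently $W(Q)^n(y|x)=Q^n(y-x)$ where $Q^n(z)=\prod_{i=1}^nQ(z_i|z_{i-1})$, $z_0=s_0$. $P_Q$ is the stationary distribution of $Q$, $H(Q)=\sum_xP_Q(x)H(Q(\cdot|x))$ (Shannon entropy, natural log), and $C_Q^{\mathrm{AM}}=\log d-H(Q)$. $V(Q)$ denotes the asymptotic variance $\lim_{n\to\infty}\frac1n\mathrm{Var}_{Q^n}(-\log Q^n(Z))$ of the Markov chain's log-likelihood (the paper writes it as $\sum_{y,x}Q(y|x)P_Q(x)(-\log Q(y|x)-H(Q))^2+2\sum_{z,y,x}Q(z|y)Q(y|x)P_Q(x)(-\log Q(z|y)-H(Q))(-\log Q(y|x)-H(Q))$). A code for $W(Q)^n$ is $\Phi=(N,\phi,\{\mathcal D_i\})$, $\phi:\{1..N\}\to\mathbb Z_d^n$, disjoint $\mathcal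 D_i\subset\mathbb Z_d^n$, $|\Phi|=N$, $P_e(\Phi)=\frac1N\sum_i(1-W(Q)^n_{\phi(i)}(\mathcal D_i))$. Over all code sequences: $C_p^{\mathrm{AM}}(a|Q)=\inf\{\limsup_nP_e(\Phi_n):\liminf_n\frac1{\sqrt n}(\log|\Phi_n|-nC_Q^{\mathrm{AM}})\ge a\}$, $C^{\mathrm{AM}}(\epsilon|Q)=\sup\{\liminf_n\frac1{\sqrt n}(\log|\Phi_n|-nC^{\mathrm{AM}}_Q):\limsup_nP_e(\Phi_n)\le\epsilon\}$. $G$ is the standard normal distribution function. *)

(* Defs.v *)
From Stdlib Require Import Reals Lra Lia List ClassicalEpsilon.
Import ListNotations.
Open Scope R_scope.

Definition phi (t : R) : R := exp (- (t * t) / 2) * / sqrt (2 * PI).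

Lemma phi_cont : continuity phi.
Proof.
  unfold phi. intro t.
  apply continuity_pt_mult.
  - apply (continuity_pt_comp (fun t => - (t * t) / 2) exp).
    + unfold Rdiv. apply continuity_pt_mult.
      * apply continuity_pt_opp. apply continuity_pt_mult; apply derivable_continuous_pt; apply derivable_pt_id.
      * apply continuity_pt_const. intros a b; reflexivity.
    + apply derivable_continuous_pt; apply derivable_pt_exp.
  - apply continuity_pt_const. intros a b; reflexivity.
Qed.

Definition phi_int (x : R) : Riemann_integrable phi 0 x :=
  match Rle_dec 0 x with
  | left h => continuity_implies_RiemannInt h (fun t _ => phi_cont t)
  | right h => RiemannInt_P1
      (continuity_implies_RiemannInt (Rlt_le _ _ (Rnot_le_lt _ _ h)) (fun t _ => phi_cont t))
  end.

Definition G (x : R) : R := / 2 + RiemannInt (phi_int x).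

(** G^{-1}(eps): the (unique, G being strictly increasing) y with G y = eps *)
Definition Ginv (eps : R) : R :=
  epsilon (inhabits 0) (fun y => G y = eps).

Definition sumR {A : Type} (l : list A) (f : A -> R) : R :=
  fold_right (fun a acc => f a + acc) 0 l.

Fixpoint all_seqs (d n : nat) : list (list nat) :=
  match n with
  | O => [[]]
  | S m => flat_map (fun a => map (cons a) (all_seqs d m)) (seq 0 d)
  end.

Definition valid (d n : nat) (x : list nat) : Prop :=
  length x = n /\ Forall (fun a => (a < d)%nat) x.

Definition zsub (d : nat) (y x : list nat) : list nat :=
  map (fun p => ((fst p + d - snd p) mod d)%nat) (combine y x).

(** Q(y|x) is written [Q y x]. *)
Fixpoint Qpow (d : nat) (Q : nat -> nat -> R) (k : nat) (y x : nat) : R :=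
  match k with
  | O => if Nat.eq_dec y x then 1 else 0
  | S k' => sumR (seq 0 d) (fun z => Q y z * Qpow d Q k' z x)
  end.

Definition stochastic (d : nat) (Q : nat -> nat -> R) : Prop :=
  (forall x y, (x < d)%nat -> (y < d)%nat -> 0 <= Q y x) /\
  (forall x, (x < d)%nat -> sumR (seq 0 d) (fun y => Q y x) = 1).

Definition irreducible (d : nat) (Q : nat -> nat -> R) : Prop :=
  forall x y, (x < d)%nat -> (y < d)%nat -> exists k, 0 < Qpow d Q k y x.

Definition stationary (d : nat) (Q : nat -> nat -> R) (P : nat -> R) : Prop :=
  (forall x, (x < d)%nat -> 0 <= P x) /\
  sumR (seq 0 d) P = 1 /\
  (forall y, (y < d)%nat -> sumR (seq 0 d) (fun x => Q y x * P x) = P y).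

Fixpoint Qseq (Q : nat -> nat -> R) (prev : nat) (z : list nat) : R :=
  match z with
  | [] => 1
  | a :: zs => Q a prev * Qseq Q a zs
  end.

Definition Wch (d : nat) (Q : nat -> nat -> R) (s0 : nat) (y x : list nat) : R :=
  Qseq Q s0 (zsub d y x).

Definition ent (p : R) : R := if Rle_dec p 0 then 0 else - p * ln p.

Definition HQ (d : nat) (Q : nat -> nat -> R) (P : nat -> R) : R :=
  sumR (seq 0 d) (fun x => P x * sumR (seq 0 d) (fun y => ent (Q y x))).

Definition CAM (d : nat) (Q : nat -> nat -> R) (P : nat -> R) : R :=
  ln (INR d) - HQ d Q P.

Definition meanLL (d n : nat) (Q : nat -> nat -> R) (s0 : nat) : R :=
  sumR (all_seqs d n) (fun z => Qseq Q s0 z * (- ln (Qseq Q s0 z))).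

Definition varLL (d n : nat) (Q : nat -> nat -> R) (s0 : nat) : R :=
  sumR (all_seqs d n)
    (fun z => Qseq Q s0 z * Rsqr (- ln (Qseq Q s0 z) - meanLL d n Q s0)).

Record code := mkCode {
  csize : nat;                      (* N; messages are 0 .. N-1 *)
  cenc : nat -> list nat;
  cdec : nat -> list nat -> bool    (* decoding sets D_i *)
}.

Definition is_code (d n : nat) (c : code) : Prop :=
  (1 <= csize c)%nat /\
  (forall i, (i < csize c)%nat -> valid d n (cenc c i)) /\
  (forall i j y, (i < csize c)%nat -> (j < csize c)%nat -> i <> j ->
     cdec c i y = true -> cdec c j y = true -> False).

Definition Pe (d n : nat) (Q : nat -> nat -> R) (s0 : nat) (c : code) : R :=
  / INR (csize c) *
  sumR (seq 0 (csize c))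
    (fun i => 1 - sumR (all_seqs d n)
                  (fun y => if cdec c i y then Wch d Q s0 y (cenc c i) else 0)).

Definition rate (d n : nat) (Q : nat -> nat -> R) (P : nat -> R) (c : code) : R :=
  (ln (INR (csize c)) - INR n * CAM d Q P) / sqrt (INR n).

Definition is_limsup (u : nat -> R) (L : R) : Prop :=
  forall eps, 0 < eps ->
    (exists N, forall n, (N <= n)%nat -> u n <= L + eps) /\
    (forall N, exists n, (N <= n)%nat /\ L - eps <= u n).

(** liminf_n u_n >= a (in the extended reals) *)
Definition liminf_ge (u : nat -> R) (a : R) : Prop :=
  forall eps, 0 < eps -> exists N, forall n, (N <= n)%nat -> a - eps <= u n.

Definition is_inf (S : R -> Prop) (m : R) : Prop :=
  (forall s, S s -> m <= s) /\
  (forall m', (forall s, S s -> m' <= s) -> m' <= m).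

(** set whose infimum is C_p^AM(a|Q) *)
Definition CpSet (d : nat) (Q : nat -> nat -> R) (s0 : nat) (P : nat -> R) (a : R)
  : R -> Prop :=
  fun r => exists cs : nat -> code,
    (forall n, is_code d n (cs n)) /\
    liminf_ge (fun n => rate d n Q P (cs n)) a /\
    is_limsup (fun n => Pe d n Q s0 (cs n)) r.

(** set whose supremum is C^AM(eps|Q): all real r such that some code sequence
    with limsup error <= eps has liminf of the second-order rate >= r *)
Definition CSet (d : nat) (Q : nat -> nat -> R) (s0 : nat) (P : nat -> R) (eps : R)
  : R -> Prop :=
  fun r => exists cs : nat -> code,
    (forall n, is_code d n (cs n)) /\
    (exists L, is_limsup (fun n => Pe d n Q s0 (cs n)) L /\ L <= eps) /\
    liminf_ge (fun n => rate d n Q P (cs n)) r.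

(* Main.v *)
(** Additive noise turns the decoding problem into a statement on the information density
    [- ln (Q^n z)]: a threshold [T] gives [Pe >= P(Q^n <= T) - T d^n / N] for every code of size [N]
    (uniform counting), and a greedy construction over the shifts of [{Q^n > T}] gives codes with
    [Pe <= P(Q^n <= T) + (N - 1) / (T d^n)].  Both matching bounds reduce to the central limit theorem
    for [- ln (Q^n Z) - n H].

    The central limit theorem is proved by the heat equation: [u t s = G ((s - c) / sqrt t)] is
    corrected by [h] and [w], solutions of two Poisson equations of the chain, into an approximate
    solution of the backward equation of the pair (state, scaled sum) with error [O (n^(-3/2))] per step.
    The same correctors, applied to [s] and to [s^2 + s2 * t], give exact moment identities, which
    identify the variance [s2] of the limit with [V]. *)

Require Import Defs.
From Stdlib Require Import Reals ZArith List Lra Lia Arith Permutation ClassicalEpsilon.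
From Coquelicot Require Import Coquelicot.
Open Scope R_scope.

(** * Finite sums and linear systems *)

(** An irreducible chain may be periodic, so powers of [Q] need not converge and the correctors
    cannot be summed as series. They come from linear algebra: the maximum principle leaves only
    constants as harmonic functions, and injectivity gives surjectivity in finite dimension. A
    Poisson equation is solved here for sources of zero mean under [P]; this fixes [H] as the drift
    and [s2] as the diffusion constant.

    With eps = n^(-1/2) the ansatz is u + eps h u_s + eps^2 w u_ss. Averaging over one step, [h]
    absorbs the order eps, and [w] turns the order eps^2 into (s2/2) u_ss, which is s2 u_t, the
    advance of the clock. What remains is eps^3 per step, hence n^(-1/2) after n steps.

    Derivatives of u blow up at t = 0, so the clock starts at [del > 0] and the indicator is
    sandwiched between two smooth profiles shifted by [eta]; [del = eta^4] makes shift and smoothing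
    error vanish together. The limits of [G] at infinity need the Gaussian integral, because [G] is
    defined by an integral from 0. *)

Section FiniteSums.
Context {A : Type}.
Implicit Types (l : list A) (f g : A -> R).

Lemma sumR_ext l f g : (forall x, In x l -> f x = g x) -> sumR l f = sumR l g.
Proof.
  induction l as [|a l IH]; simpl; intros H; [reflexivity|].
  rewrite H, IH; auto.
Qed.

Lemma sumR_le l f g : (forall x, In x l -> f x <= g x) -> sumR l f <= sumR l g.
Proof.
  induction l as [|a l IH]; simpl; intros H; [lra|].
  apply Rplus_le_compat; auto.
Qed.

Lemma sumR_plus l f g : sumR l (fun x => f x + g x) = sumR l f + sumR l g.
Proof. induction l as [|a l IH]; simpl; [|rewrite IH]; ring. Qed.

Lemma sumR_scal l c f : sumR l (fun x => c * f x) = c * sumR l f.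
Proof. induction l as [|a l IH]; simpl; [|rewrite IH]; ring. Qed.

Lemma sumR_scal_r l c f : sumR l (fun x => f x * c) = sumR l f * c.
Proof. induction l as [|a l IH]; simpl; [|rewrite IH]; ring. Qed.

Lemma sumR_minus l f g : sumR l (fun x => f x - g x) = sumR l f - sumR l g.
Proof. induction l as [|a l IH]; simpl; [|rewrite IH]; ring. Qed.

Lemma sumR_const l c : sumR l (fun _ => c) = INR (length l) * c.
Proof.
  induction l as [|a l IH]; [simpl; ring|].
  change (length (a :: l)) with (S (length l)). rewrite S_INR. simpl. rewrite IH. ring.
Qed.

Lemma sumR_zero l f : (forall x, In x l -> f x = 0) -> sumR l f = 0.
Proof.
  intros H. rewrite (sumR_ext l f (fun _ => 0) H), sumR_const. ring.
Qed.

Lemma sumR_nonneg l f : (forall x, In x l -> 0 <= f x) -> 0 <= sumR l f.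
Proof.
  intros H. rewrite <- (sumR_zero l (fun _ => 0)) by auto. now apply sumR_le.
Qed.

Lemma sumR_abs_le l f : Rabs (sumR l f) <= sumR l (fun x => Rabs (f x)).
Proof.
  induction l as [|a l IH]; simpl; [rewrite Rabs_R0; lra|].
  eapply Rle_trans; [apply Rabs_triang|]. lra.
Qed.

Lemma sumR_app l1 l2 f : sumR (l1 ++ l2) f = sumR l1 f + sumR l2 f.
Proof. induction l1 as [|a l IH]; simpl; [|rewrite IH]; ring. Qed.

Lemma sumR_perm l1 l2 f : Permutation l1 l2 -> sumR l1 f = sumR l2 f.
Proof. induction 1; simpl; lra. Qed.

Lemma sumR_member_le l f x : (forall y, In y l -> 0 <= f y) -> In x l -> f x <= sumR l f.
Proof.
  intros Hf Hx. induction l as [|a l IH]; simpl in *; [easy|].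
  assert (0 <= sumR l f) by (apply sumR_nonneg; auto).
  destruct Hx as [->|Hx]; [lra|].
  assert (0 <= f a) by auto. specialize (IH (fun y h => Hf y (or_intror h)) Hx). lra.
Qed.

(** Some term is at most the average; the greedy code construction picks its next codeword this
    way. *)
Lemma sumR_exists_le_average l f c :
  l <> nil -> sumR l f <= INR (length l) * c -> exists x, In x l /\ f x <= c.
Proof.
  intros Hl. induction l as [|a l IH]; [easy|]. intros H.
  destruct (Rle_dec (f a) c) as [h|h]; [exists a; simpl; auto|].
  change (length (a :: l)) with (S (length l)) in H. rewrite S_INR in H. simpl in H.
  destruct l as [|b l].
  - simpl in H. lra.
  - destruct IH as (x & Hx & Hc); [discriminate|lra|]. exists x; simpl in *; auto.
Qed.
End FiniteSums.

Lemma sumR_map {A B} (l : list A) (g : A -> B) (f : B -> R) :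
  sumR (map g l) f = sumR l (fun x => f (g x)).
Proof. induction l as [|a l IH]; simpl; [|rewrite IH]; reflexivity. Qed.

Lemma sumR_flat_map {A B} (l : list A) (g : A -> list B) (f : B -> R) :
  sumR (flat_map g l) f = sumR l (fun x => sumR (g x) f).
Proof. induction l as [|a l IH]; simpl; [|rewrite sumR_app, IH]; reflexivity. Qed.

Lemma sumR_swap {A B} (l : list A) (m : list B) (f : A -> B -> R) :
  sumR l (fun x => sumR m (fun y => f x y)) = sumR m (fun y => sumR l (fun x => f x y)).
Proof.
  induction l as [|a l IH]; simpl.
  - now rewrite sumR_zero.
  - rewrite IH, sumR_plus. reflexivity.
Qed.

Lemma sumR_seq_S n f : sumR (seq 0 (S n)) f = sumR (seq 0 n) f + f n.
Proof. rewrite seq_S, sumR_app. simpl. ring. Qed.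

Lemma in_seq0 n x : In x (seq 0 n) <-> (x < n)%nat.
Proof. rewrite in_seq. lia. Qed.

Lemma sumR_seq_ext n f g :
  (forall x, (x < n)%nat -> f x = g x) -> sumR (seq 0 n) f = sumR (seq 0 n) g.
Proof. intros H. apply sumR_ext. intros x Hx. apply H. now apply in_seq0. Qed.

Lemma sumR_seq_le n f g :
  (forall x, (x < n)%nat -> f x <= g x) -> sumR (seq 0 n) f <= sumR (seq 0 n) g.
Proof. intros H. apply sumR_le. intros x Hx. apply H. now apply in_seq0. Qed.

Lemma sumR_seq_indicator n j c : (j < n)%nat ->
  sumR (seq 0 n) (fun x => (if Nat.eq_dec x j then 1 else 0) * c x) = c j.
Proof.
  induction n as [|n IH]; [lia|]. intros Hj. rewrite sumR_seq_S.
  destruct (Nat.eq_dec n j) as [->|Hn].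
  - rewrite sumR_zero; [ring|]. intros x Hx. apply in_seq0 in Hx.
    destruct (Nat.eq_dec x j); [lia|ring].
  - rewrite IH by lia. ring.
Qed.

(** Gaussian elimination, by induction on the number of equations: a row with nonzero last
    coefficient eliminates the last unknown; if there is none, the last unit vector is a
    solution. *)
Lemma homogeneous_system_nontrivial m (a : nat -> nat -> R) :
  exists v : nat -> R, (exists j, (j <= m)%nat /\ v j <> 0) /\
    forall i, (i < m)%nat -> sumR (seq 0 (S m)) (fun j => a i j * v j) = 0.
Proof.
  revert a. induction m as [|m IH]; intros a.
  - exists (fun _ => 1). split; [|intros; lia]. exists 0%nat. split; [lia|lra].
  - destruct (Classical_Prop.classic (exists r, (r < S m)%nat /\ a r (S m) <> 0)) as [(r & Hr & Har)|Hno].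
    (* [sk] enumerates the rows other than the pivot row [r]; [last] is the value of the last
       unknown that satisfies row [r]. *)
    + set (sk := fun i => if lt_dec i r then i else S i).
      destruct (IH (fun i j => a (sk i) j - a (sk i) (S m) / a r (S m) * a r j)) as (v & (j0 & Hj0 & Hv) & Hs).
      set (last := - sumR (seq 0 (S m)) (fun j => a r j * v j) / a r (S m)).
      set (v' := fun j => if Nat.eq_dec j (S m) then last else v j).
      assert (Hsum : forall i, sumR (seq 0 (S (S m))) (fun j => a i j * v' j)
                 = sumR (seq 0 (S m)) (fun j => a i j * v j) + a i (S m) * last).
      { intros i. rewrite sumR_seq_S. f_equal.
        - apply sumR_seq_ext. intros x Hx. unfold v'. destruct (Nat.eq_dec x (S m)); [lia|reflexivity].
        - unfold v'. destruct (Nat.eq_dec (S m) (S m)); [reflexivity|lia]. }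
      assert (Hskip : forall i, (i < m)%nat ->
                 sumR (seq 0 (S (S m))) (fun j => a (sk i) j * v' j) = 0).
      { intros i Hi. rewrite Hsum. specialize (Hs i Hi). cbv beta in Hs.
        rewrite (sumR_ext _ _ (fun j => a (sk i) j * v j - (a (sk i) (S m) / a r (S m)) * (a r j * v j))) in Hs
          by (intros; ring).
        rewrite sumR_minus, sumR_scal in Hs. unfold last.
        replace (sumR (seq 0 (S m)) (fun j => a (sk i) j * v j))
          with (a (sk i) (S m) / a r (S m) * sumR (seq 0 (S m)) (fun j => a r j * v j)) by lra.
        field. exact Har. }
      exists v'. split.
      * exists j0. split; [lia|]. unfold v'. destruct (Nat.eq_dec j0 (S m)); [lia|exact Hv].
      * intros i Hi. destruct (lt_eq_lt_dec i r) as [[h|h]|h].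
        -- specialize (Hskip i ltac:(lia)). unfold sk in Hskip.
           destruct (lt_dec i r); [exact Hskip|lia].
        -- subst i. rewrite Hsum. unfold last. field. exact Har.
        -- specialize (Hskip (pred i) ltac:(lia)). unfold sk in Hskip.
           destruct (lt_dec (pred i) r); [lia|]. replace (S (pred i)) with i in Hskip by lia. exact Hskip.
    + exists (fun j => if Nat.eq_dec j (S m) then 1 else 0). split.
      * exists (S m). split; [lia|]. destruct (Nat.eq_dec (S m) (S m)); [lra|lia].
      * intros i Hi. rewrite sumR_seq_S. rewrite sumR_zero.
        -- destruct (Nat.eq_dec (S m) (S m)); [|lia].
           destruct (Req_dec (a i (S m)) 0) as [->|h]; [ring|]. exfalso. apply Hno. eauto.
        -- intros x Hx. apply in_seq0 in Hx. destruct (Nat.eq_dec x (S m)); [lia|ring].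
Qed.

(** Appending the column [- g] gives one unknown more than equations, hence a nontrivial solution.
    Injectivity forbids its last coordinate to vanish, and dividing by that coordinate gives a
    preimage of [g]. *)
Lemma injective_matrix_surjective d (a : nat -> nat -> R) :
  (forall h, (forall i, (i < d)%nat -> sumR (seq 0 d) (fun j => a i j * h j) = 0) ->
     forall i, (i < d)%nat -> h i = 0) ->
  forall g, exists h, forall i, (i < d)%nat -> sumR (seq 0 d) (fun j => a i j * h j) = g i.
Proof.
  intros Hinj g.
  destruct (homogeneous_system_nontrivial d (fun i j => if Nat.eq_dec j d then - g i else a i j))
    as (v & (j0 & Hj0 & Hv) & Hs).
  assert (Hs' : forall i, (i < d)%nat -> sumR (seq 0 d) (fun j => a i j * v j) = g i * v d).
  { intros i Hi. specialize (Hs i Hi). rewrite sumR_seq_S in Hs.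
    destruct (Nat.eq_dec d d); [|lia].
    rewrite (sumR_seq_ext _ _ (fun j => a i j * v j)) in Hs.
    - lra.
    - intros x Hx. destruct (Nat.eq_dec x d); [lia|reflexivity]. }
  destruct (Req_dec (v d) 0) as [h0|h0].
  - exfalso. apply Hv. destruct (Nat.eq_dec j0 d) as [->|]; [exact h0|].
    apply Hinj; [|lia]. intros i Hi. rewrite Hs', h0 by exact Hi. ring.
  - exists (fun j => v j / v d). intros i Hi.
    rewrite (sumR_ext _ _ (fun j => a i j * v j * / v d)) by (intros; unfold Rdiv; ring).
    rewrite sumR_scal_r, Hs' by exact Hi. field. exact h0.
Qed.

(** * Harmonic functions and the Poisson equation of the chain *)

Section Chain.
Variables (d : nat) (Q : nat -> nat -> R).
Hypothesis (HQ : stochastic d Q).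

Lemma Qpow_nonneg k x y : (x < d)%nat -> (y < d)%nat -> 0 <= Qpow d Q k y x.
Proof.
  destruct HQ as [Hn _]. revert y. induction k as [|k IH]; simpl; intros y Hx Hy.
  - destruct (Nat.eq_dec y x); lra.
  - apply sumR_nonneg. intros z Hz. apply in_seq0 in Hz. apply Rmult_le_pos; auto.
Qed.

Lemma Qpow_harmonic h :
  (forall x, (x < d)%nat -> sumR (seq 0 d) (fun y => Q y x * h y) = h x) ->
  forall k x, (x < d)%nat -> sumR (seq 0 d) (fun y => Qpow d Q k y x * h y) = h x.
Proof.
  intros Hh k x Hx. induction k as [|k IH]; simpl.
  - now apply sumR_seq_indicator.
  - rewrite <- IH.
    rewrite (sumR_ext _ _ (fun y => sumR (seq 0 d) (fun z => Qpow d Q k z x * (Q y z * h y)))).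
    + rewrite sumR_swap. apply sumR_seq_ext. intros z Hz.
      rewrite sumR_scal, Hh by exact Hz. reflexivity.
    + intros y _. rewrite <- sumR_scal_r. apply sumR_ext. intros; ring.
Qed.

Lemma exists_argmax (h : nat -> R) n : (1 <= n)%nat ->
  exists m, (m < n)%nat /\ forall x, (x < n)%nat -> h x <= h m.
Proof.
  induction n as [|n IH]; [lia|]. intros _. destruct n as [|n].
  - exists 0%nat. split; [lia|]. intros x Hx. replace x with 0%nat by lia. lra.
  - destruct IH as (m & Hm & Hmax); [lia|].
    destruct (Rle_dec (h m) (h (S n))) as [hl|hl].
    + exists (S n). split; [lia|]. intros x Hx. destruct (Nat.eq_dec x (S n)) as [->|]; [lra|].
      specialize (Hmax x ltac:(lia)). lra.
    + exists m. split; [lia|]. intros x Hx. destruct (Nat.eq_dec x (S n)) as [->|]; [lra|].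
      apply Hmax; lia.
Qed.

(** Maximum principle. From an argmax [m], the nonnegative defects [h m - h z] average to 0 under
    every power of [Q], so they vanish wherever some power has positive weight; by irreducibility
    that is everywhere. *)
Lemma harmonic_constant h : (1 <= d)%nat -> irreducible d Q ->
  (forall x, (x < d)%nat -> sumR (seq 0 d) (fun y => Q y x * h y) = h x) ->
  exists c, forall x, (x < d)%nat -> h x = c.
Proof.
  intros Hd Hirr Hh. destruct (exists_argmax h d Hd) as (m & Hm & Hmax).
  exists (h m). intros y Hy. destruct (Hirr m y Hm Hy) as (k & Hk).
  assert (Hone : sumR (seq 0 d) (fun z => Qpow d Q k z m * 1) = 1).
  { apply (Qpow_harmonic (fun _ => 1)); [|exact Hm]. intros x Hx.
    rewrite sumR_scal_r, (proj2 HQ x Hx). ring. }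
  pose proof (Qpow_harmonic h Hh k m Hm) as Hsum.
  assert (H0 : sumR (seq 0 d) (fun z => Qpow d Q k z m * (h m - h z)) = 0).
  { rewrite (sumR_ext _ _ (fun z => (Qpow d Q k z m * 1) * h m - Qpow d Q k z m * h z)) by (intros; ring).
    rewrite sumR_minus, sumR_scal_r, Hone, Hsum. ring. }
  assert (Hle : Qpow d Q k y m * (h m - h y) <= 0).
  { rewrite <- H0.
    apply (sumR_member_le _ (fun z => Qpow d Q k z m * (h m - h z))); [|now apply in_seq0].
    intros z Hz. apply in_seq0 in Hz. apply Rmult_le_pos; [now apply Qpow_nonneg|].
    specialize (Hmax z Hz). lra. }
  specialize (Hmax y Hy).
  destruct (Req_dec (h m - h y) 0); [lra|].
  assert (0 < Qpow d Q k y m * (h m - h y)) by (apply Rmult_lt_0_compat; lra). lra.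
Qed.

(* [h - Qh + (P.h) 1] is injective in [h], hence onto; applying [P] shows that the extra term
   vanishes on the preimage of [g]. *)
Lemma poisson_equation P g : (1 <= d)%nat -> irreducible d Q -> stationary d Q P ->
  sumR (seq 0 d) (fun x => P x * g x) = 0 ->
  exists h, forall x, (x < d)%nat -> h x = g x + sumR (seq 0 d) (fun y => Q y x * h y).
Proof.
  intros Hd Hirr (HPn & HP1 & HPs) Hg.
  set (a := fun x y => (if Nat.eq_dec y x then 1 else 0) - Q y x + P y).
  assert (Ha : forall h x, (x < d)%nat -> sumR (seq 0 d) (fun y => a x y * h y)
     = h x - sumR (seq 0 d) (fun y => Q y x * h y) + sumR (seq 0 d) (fun y => P y * h y)).
  { intros h x Hx. rewrite <- (sumR_seq_indicator d x h Hx).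
    rewrite <- sumR_minus, <- sumR_plus. apply sumR_ext. intros y _. unfold a. ring. }
  (* By stationarity the first two terms of [a] cancel under [P], so [P] is a left fixed vector of
     [a]. *)
  assert (HPa : forall h, sumR (seq 0 d) (fun x => P x * sumR (seq 0 d) (fun y => a x y * h y))
     = sumR (seq 0 d) (fun y => P y * h y)).
  { intros h.
    rewrite (sumR_seq_ext _ _ (fun x => P x * h x - P x * sumR (seq 0 d) (fun y => Q y x * h y)
        + P x * sumR (seq 0 d) (fun y => P y * h y))).
    2:{ intros x Hx. rewrite Ha by exact Hx. ring. }
    rewrite sumR_plus, sumR_minus, sumR_scal_r, HP1.
    replace (sumR (seq 0 d) (fun x => P x * sumR (seq 0 d) (fun y => Q y x * h y)))
      with (sumR (seq 0 d) (fun y => P y * h y)); [ring|].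
    rewrite (sumR_ext (seq 0 d) (fun x => P x * sumR (seq 0 d) (fun y => Q y x * h y))
        (fun x => sumR (seq 0 d) (fun y => (Q y x * P x) * h y))).
    - rewrite sumR_swap. apply sumR_seq_ext. intros y Hy. rewrite sumR_scal_r, HPs by exact Hy. ring.
    - intros x _. rewrite <- sumR_scal. apply sumR_ext. intros; ring. }
  destruct (injective_matrix_surjective d a) with (g := g) as (h & Hh).
  - intros h Hh.
    assert (HPh : sumR (seq 0 d) (fun y => P y * h y) = 0).
    { rewrite <- HPa. apply sumR_zero. intros x Hx. apply in_seq0 in Hx. rewrite Hh by exact Hx. ring. }
    destruct (harmonic_constant h Hd Hirr) as (c & Hc).
    { intros x Hx. specialize (Hh x Hx). rewrite Ha, HPh in Hh by exact Hx. lra. }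
    rewrite (sumR_seq_ext _ _ (fun y => P y * c)) in HPh
      by (intros y Hy; now rewrite Hc).
    rewrite sumR_scal_r, HP1 in HPh. intros i Hi. rewrite Hc by exact Hi. lra.
  - exists h. intros x Hx. pose proof (Hh x Hx) as E. rewrite Ha in E by exact Hx.
    assert (HPh : sumR (seq 0 d) (fun y => P y * h y) = 0).
    { rewrite <- HPa, <- Hg. apply sumR_seq_ext. intros y Hy. now rewrite Hh. }
    lra.
Qed.
End Chain.

(** * Expectations along the chain and the asymptotic variance *)

Lemma all_seqs_valid d n z : In z (all_seqs d n) -> valid d n z.
Proof.
  revert z. induction n as [|n IH]; simpl; intros z Hz.
  - destruct Hz as [<-|[]]. split; [reflexivity|constructor].
  - apply in_flat_map in Hz. destruct Hz as (a & Ha & Hz).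
    apply in_map_iff in Hz. destruct Hz as (z' & <- & Hz').
    destruct (IH z' Hz') as [Hl Hf]. split; [simpl; now rewrite Hl|].
    constructor; [now apply in_seq0|exact Hf].
Qed.

Lemma finite_bound d (f : nat -> R) : exists B, 0 <= B /\ forall x, (x < d)%nat -> Rabs (f x) <= B.
Proof.
  exists (sumR (seq 0 d) (fun x => Rabs (f x))). split.
  - apply sumR_nonneg. intros; apply Rabs_pos.
  - intros x Hx. apply (sumR_member_le _ (fun x => Rabs (f x))); [intros; apply Rabs_pos|].
    now apply in_seq0.
Qed.

Lemma sqrt_INR_unbounded K : exists N, forall n, (N <= n)%nat -> (1 <= n)%nat /\ K <= sqrt (INR n).
Proof.
  destruct (INR_unbounded (K * K)) as (N & HN). exists (S N). intros n Hn. split; [lia|].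
  destruct (Rle_dec K 0) as [h|h].
  - eapply Rle_trans; [exact h|]. apply sqrt_pos.
  - rewrite <- (sqrt_square K) by lra. apply sqrt_le_1_alt.
    apply Rlt_le in HN. eapply Rle_trans; [exact HN|]. apply le_INR. lia.
Qed.

Lemma div_sqrt_INR_small C eps : 0 < eps ->
  exists N, forall n, (N <= n)%nat -> (1 <= n)%nat /\ C / sqrt (INR n) < eps.
Proof.
  intros He. destruct (sqrt_INR_unbounded (Rabs C / eps + 1)) as (N & HN).
  exists N. intros n Hn. destruct (HN n Hn) as [H1 HK]. split; [exact H1|].
  assert (0 <= Rabs C / eps) by (apply Rmult_le_pos; [apply Rabs_pos|left; now apply Rinv_0_lt_compat]).
  assert (0 < sqrt (INR n)) by lra.
  apply (Rmult_lt_reg_r (sqrt (INR n))); [assumption|].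
  replace (C / sqrt (INR n) * sqrt (INR n)) with C by (field; lra).
  apply Rle_lt_trans with (Rabs C); [apply Rle_abs|].
  apply Rlt_le_trans with (eps * (Rabs C / eps + 1)).
  - replace (eps * (Rabs C / eps + 1)) with (Rabs C + eps) by (field; lra). lra.
  - apply Rmult_le_compat_l; lra.
Qed.

Fixpoint path_sum (e : nat -> nat -> R) (x : nat) (z : list nat) : R :=
  match z with
  | nil => 0
  | y :: z' => e x y + path_sum e y z'
  end.

Fixpoint endpoint (x : nat) (z : list nat) : nat :=
  match z with
  | nil => x
  | y :: z' => endpoint y z'
  end.

Lemma endpoint_lt d n x z : (x < d)%nat -> valid d n z -> (endpoint x z < d)%nat.
Proof.
  intros Hx [_ Hf]. revert x Hx. induction Hf; simpl; auto.
Qed.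

Lemma path_sum_scal c e x z : path_sum (fun x y => c * e x y) x z = c * path_sum e x z.
Proof. revert x. induction z as [|y z IH]; simpl; intros x; [|rewrite IH]; ring. Qed.

Definition Eseq (d : nat) (Q : nat -> nat -> R) (n x : nat) (F : list nat -> R) : R :=
  sumR (all_seqs d n) (fun z => Qseq Q x z * F z).

(** Centred information density of one transition. Where [Q y x = 0] the convention for [ln] gives
    the finite value [- H], which always enters with weight 0. *)
Definition infdev (Q : nat -> nat -> R) (H : R) (x y : nat) : R := - ln (Q y x) - H.

Section Expectation.
Variables (d : nat) (Q : nat -> nat -> R).
Hypothesis (HQ : stochastic d Q).

Lemma Eseq_S n x F :
  Eseq d Q (S n) x F = sumR (seq 0 d) (fun y => Q y x * Eseq d Q n y (fun z => F (y :: z))).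
Proof.
  unfold Eseq. simpl. rewrite sumR_flat_map. apply sumR_ext. intros y _.
  rewrite sumR_map, <- sumR_scal. apply sumR_ext. intros z _. simpl. ring.
Qed.

Lemma Qseq_nonneg n x z : (x < d)%nat -> valid d n z -> 0 <= Qseq Q x z.
Proof.
  intros Hx [_ Hf]. destruct HQ as [Hn _]. revert x Hx.
  induction Hf; simpl; intros x0 Hx; [lra|]. apply Rmult_le_pos; auto.
Qed.

Lemma Eseq_one n x : (x < d)%nat -> Eseq d Q n x (fun _ => 1) = 1.
Proof.
  revert x. induction n as [|n IH]; intros x Hx.
  - unfold Eseq; simpl; ring.
  - rewrite Eseq_S. rewrite (sumR_seq_ext _ _ (fun y => Q y x)).
    + now apply HQ.
    + intros y Hy. rewrite IH by exact Hy. ring.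
Qed.

(** Comparison is restricted to sequences of positive probability, since the logarithm of a
    vanishing product does not split into a sum. *)
Lemma Eseq_ext n x F F' : (x < d)%nat ->
  (forall z, valid d n z -> 0 < Qseq Q x z -> F z = F' z) -> Eseq d Q n x F = Eseq d Q n x F'.
Proof.
  intros Hx H. apply sumR_ext. intros z Hz. apply all_seqs_valid in Hz.
  destruct (Qseq_nonneg n x z Hx Hz) as [h|<-]; [now rewrite H|ring].
Qed.

Lemma Eseq_le n x F F' : (x < d)%nat ->
  (forall z, valid d n z -> 0 < Qseq Q x z -> F z <= F' z) -> Eseq d Q n x F <= Eseq d Q n x F'.
Proof.
  intros Hx H. apply sumR_le. intros z Hz. apply all_seqs_valid in Hz.
  destruct (Qseq_nonneg n x z Hx Hz) as [h|<-]; [|lra].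
  apply Rmult_le_compat_l; [lra|auto].
Qed.

Lemma Eseq_plus n x F F' :
  Eseq d Q n x (fun z => F z + F' z) = Eseq d Q n x F + Eseq d Q n x F'.
Proof. unfold Eseq. rewrite <- sumR_plus. apply sumR_ext. intros; ring. Qed.

Lemma Eseq_scal n x c F : Eseq d Q n x (fun z => c * F z) = c * Eseq d Q n x F.
Proof. unfold Eseq. rewrite <- sumR_scal. apply sumR_ext. intros; ring. Qed.

Lemma Eseq_const n x c : (x < d)%nat -> Eseq d Q n x (fun _ => c) = c.
Proof.
  intros Hx. rewrite (Eseq_ext n x _ (fun _ => c * 1)) by (auto; intros; ring).
  rewrite Eseq_scal, Eseq_one by exact Hx. ring.
Qed.

Lemma Eseq_abs_le n x F : (x < d)%nat ->
  Rabs (Eseq d Q n x F) <= Eseq d Q n x (fun z => Rabs (F z)).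
Proof.
  intros Hx. eapply Rle_trans; [apply sumR_abs_le|]. right. apply sumR_ext.
  intros z Hz. apply all_seqs_valid in Hz. rewrite Rabs_mult. f_equal.
  apply Rabs_pos_eq. exact (Qseq_nonneg n x z Hx Hz).
Qed.

Lemma Eseq_approx n x F F' c : (x < d)%nat ->
  (forall z, valid d n z -> 0 < Qseq Q x z -> Rabs (F z - F' z) <= c) ->
  Rabs (Eseq d Q n x F - Eseq d Q n x F') <= c.
Proof.
  intros Hx H.
  replace (Eseq d Q n x F - Eseq d Q n x F') with (Eseq d Q n x (fun z => F z + -1 * F' z))
    by (rewrite Eseq_plus, Eseq_scal; ring).
  eapply Rle_trans; [apply Eseq_abs_le; exact Hx|].
  rewrite <- (Eseq_const n x c Hx). apply Eseq_le; [exact Hx|].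
  intros z Hz Hq. replace (F z + -1 * F' z) with (F z - F' z) by ring. auto.
Qed.

(* [A k] is an approximate solution of the backward Kolmogorov equation with [k] steps to go. *)
Lemma Eseq_backward (A : nat -> nat -> R -> R) e err n :
  (forall k x s, (k < n)%nat -> (x < d)%nat ->
     Rabs (sumR (seq 0 d) (fun y => Q y x * A k y (s + e x y)) - A (S k) x s) <= err) ->
  forall k x s, (k <= n)%nat -> (x < d)%nat ->
  Rabs (Eseq d Q k x (fun z => A 0%nat (endpoint x z) (s + path_sum e x z)) - A k x s) <= INR k * err.
Proof.
  intros Hstep k. induction k as [|k IH]; intros x s Hk Hx.
  - unfold Eseq. simpl. rewrite !Rplus_0_r.
    match goal with |- Rabs ?t <= _ => replace t with 0 by ring end. rewrite Rabs_R0. lra.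
  - rewrite Eseq_S.
    set (I := sumR (seq 0 d) (fun y => Q y x * A k y (s + e x y))).
    match goal with |- Rabs (?t - _) <= _ => set (T := t) end.
    (* [T - I] is the inductive error averaged over the first step; [I - A (S k) x s] is the defect
       of one step. *)
    replace (T - A (S k) x s) with ((T - I) + (I - A (S k) x s)) by ring.
    eapply Rle_trans; [apply Rabs_triang|]. rewrite S_INR, Rmult_plus_distr_r, Rmult_1_l.
    apply Rplus_le_compat; [|apply Hstep; auto; lia].
    unfold T, I. rewrite <- sumR_minus. eapply Rle_trans; [apply sumR_abs_le|].
    replace (INR k * err) with (sumR (seq 0 d) (fun y => Q y x * (INR k * err)))
      by (rewrite sumR_scal_r, (proj2 HQ x Hx); ring).
    apply sumR_seq_le. intros y Hy. rewrite <- Rmult_minus_distr_l, Rabs_mult.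
    assert (Hq : 0 <= Q y x) by now apply HQ.
    rewrite (Rabs_pos_eq _ Hq). apply Rmult_le_compat_l; [exact Hq|].
    eapply Rle_trans; [|apply (IH y (s + e x y)); [lia|exact Hy]]. right. do 2 f_equal.
    apply Eseq_ext; [exact Hy|]. intros z _ _. simpl. f_equal. ring.
Qed.

(** A positive product of nonnegative factors has only positive factors, so [ln] is additive along
    the path. *)
Lemma log_Qseq H n x z : (x < d)%nat -> valid d n z -> 0 < Qseq Q x z ->
  - ln (Qseq Q x z) - INR n * H = path_sum (infdev Q H) x z.
Proof.
  intros Hx [Hl Hf]. subst n. revert x Hx. induction Hf as [|y z Hy Hf IH]; intros x Hx Hp.
  - simpl. rewrite ln_1. ring.
  - change (length (y :: z)) with (S (length z)). rewrite S_INR. simpl in Hp |- *.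
    assert (0 <= Qseq Q y z) by (apply (Qseq_nonneg (length z)); [exact Hy|now split]).
    assert (0 <= Q y x) by now apply HQ.
    assert (0 < Q y x).
    { destruct (Req_dec (Q y x) 0) as [E|]; [rewrite E in Hp|]; lra. }
    assert (0 < Qseq Q y z).
    { destruct (Req_dec (Qseq Q y z) 0) as [E|]; [rewrite E in Hp|]; lra. }
    rewrite ln_mult, <- IH by assumption. unfold infdev. ring.
Qed.

(** * Asymptotic variance from the two correctors *)

Section Variance.
Variables (H s2 : R) (h w : nat -> R).
Let ell := infdev Q H.
Hypothesis Hh : forall x, (x < d)%nat ->
  sumR (seq 0 d) (fun y => Q y x * (ell x y + h y)) = h x.
Hypothesis Hw : forall x, (x < d)%nat ->
  sumR (seq 0 d) (fun y => Q y x * (ell x y * ell x y / 2 + h y * ell x y + w y)) = w x + s2 / 2.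

Let L x z := path_sum ell x z.

(** By [Hh], [s + h x] is an exact solution of the backward equation, so [Eseq_backward] applies
    with error 0 and becomes an identity. *)
Lemma first_moment n x : (x < d)%nat ->
  Eseq d Q n x (fun z => L x z + h (endpoint x z)) = h x.
Proof.
  intros Hx.
  pose proof (Eseq_backward (fun _ x s => s + h x) ell 0 n) as Hb. cbv beta in Hb.
  assert (Hz : Rabs (Eseq d Q n x (fun z => 0 + path_sum ell x z + h (endpoint x z)) - (0 + h x)) <= INR n * 0).
  { apply Hb; auto. intros k x0 s _ Hx0. right.
    rewrite (sumR_ext _ _ (fun y => Q y x0 * s + Q y x0 * (ell x0 y + h y))) by (intros; ring).
    rewrite sumR_plus, sumR_scal_r, Hh, (proj2 HQ) by exact Hx0.
    match goal with |- Rabs ?t = _ => replace t with 0 by ring end. apply Rabs_R0. }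
  rewrite Rmult_0_r in Hz.
  rewrite (Eseq_ext n x _ (fun z => 0 + path_sum ell x z + h (endpoint x z)) Hx)
    by (intros; unfold L; ring).
  unfold Rabs in Hz. destruct (Rcase_abs _) in Hz; lra.
Qed.

(** Expanding [(s + ell)^2 + 2 h y (s + ell) + 2 w y] and averaging over [y], the coefficient of [s]
    is [2 h x] by [Hh] and the constant is [2 w x + s2] by [Hw]: each step releases exactly [s2]. *)
Lemma second_moment n x : (x < d)%nat ->
  Eseq d Q n x (fun z => L x z * L x z + 2 * h (endpoint x z) * L x z + 2 * w (endpoint x z))
  = INR n * s2 + 2 * w x.
Proof.
  intros Hx.
  pose proof (Eseq_backward (fun k x s => s * s + INR k * s2 + 2 * h x * s + 2 * w x) ell 0 n) as Hb.
  cbv beta in Hb.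
  specialize (fun Hs => Hb Hs n x 0 (le_n n) Hx).
  replace (INR n * 0) with 0 in Hb by ring.
  rewrite (Eseq_ext n x _ (fun z => (0 + path_sum ell x z) * (0 + path_sum ell x z) + INR 0 * s2
     + 2 * h (endpoint x z) * (0 + path_sum ell x z) + 2 * w (endpoint x z)) Hx)
    by (intros; unfold L; simpl; ring).
  match type of Hb with _ -> Rabs ?t <= 0 => assert (Hz : Rabs t <= 0) end.
  2:{ unfold Rabs in Hz. destruct (Rcase_abs _) in Hz; lra. }
  apply Hb. intros k x0 s _ Hx0. right. rewrite S_INR.
  rewrite (sumR_ext _ _ (fun y => Q y x0 * (s * s + INR k * s2) + (2 * s) * (Q y x0 * (ell x0 y + h y))
      + 2 * (Q y x0 * (ell x0 y * ell x0 y / 2 + h y * ell x0 y + w y)))).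
  2:{ intros. field. }
  rewrite !sumR_plus, sumR_scal_r, !sumR_scal, Hh, Hw, (proj2 HQ) by exact Hx0.
  match goal with |- Rabs ?t = _ => replace t with 0 by field end. apply Rabs_R0.
Qed.

Lemma varLL_moments n x : (x < d)%nat ->
  varLL d n Q x = Eseq d Q n x (fun z => L x z * L x z) - Rsqr (Eseq d Q n x (L x)).
Proof.
  intros Hx.
  assert (Hm : meanLL d n Q x = INR n * H + Eseq d Q n x (L x)).
  { rewrite <- (Eseq_const n x (INR n * H) Hx) at 1. rewrite <- Eseq_plus.
    apply (Eseq_ext n x (fun z => - ln (Qseq Q x z))); [exact Hx|].
    intros z Hz Hq. unfold L, ell. rewrite <- (log_Qseq H n x z Hx Hz Hq). ring. }
  transitivity (Eseq d Q n x (fun z => L x z * L x z + (-2 * Eseq d Q n x (L x)) * L x z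
      + Rsqr (Eseq d Q n x (L x)))).
  - apply (Eseq_ext n x (fun z => Rsqr (- ln (Qseq Q x z) - meanLL d n Q x))); [exact Hx|].
    intros z Hz Hq. unfold L at 1 2 4, ell. rewrite <- (log_Qseq H n x z Hx Hz Hq), Hm.
    unfold Rsqr. ring.
  - rewrite !Eseq_plus, Eseq_scal, Eseq_const by exact Hx. unfold Rsqr. ring.
Qed.

(** The mean of [L] stays bounded, so only its second moment [m] matters. In [second_moment] the
    cross term [2 h L] is controlled by AM-GM with weight r = sqrt n, at cost B (m/r + r). This
    inequality first gives m = O(n), and used again, m - n s2 = O(sqrt n). *)
Lemma varLL_limit x : (x < d)%nat -> Un_cv (fun n => varLL d n Q x / INR n) s2.
Proof.
  intros Hx.
  destruct (finite_bound d h) as (B1 & HB1 & Hb1).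
  destruct (finite_bound d w) as (B2 & HB2 & Hb2).
  set (B := B1 + B2).
  assert (Hbh : forall x, (x < d)%nat -> Rabs (h x) <= B) by (intros y Hy; specialize (Hb1 y Hy); unfold B; lra).
  assert (Hbw : forall x, (x < d)%nat -> Rabs (w x) <= B) by (intros y Hy; specialize (Hb2 y Hy); unfold B; lra).
  assert (HB : 0 <= B) by (unfold B; lra). clearbody B.
  (* [K] bounds m/n: once r >= 2B + 1, the term B m/r is absorbed by m/2. In [C], the summands 5B
     and BK come from the second moment and 4 B^2 from the squared mean. *)
  set (K := 2 * (Rabs s2 + 5 * B)).
  set (C := 5 * B + B * K + 4 * (B * B)).
  intros eps He.
  destruct (div_sqrt_INR_small C eps He) as (N1 & HN1).
  destruct (sqrt_INR_unbounded (2 * B + 1)) as (N2 & HN2).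
  exists (N1 + N2)%nat. intros n Hn.
  destruct (HN1 n ltac:(lia)) as [Hn1 Heps]. destruct (HN2 n ltac:(lia)) as [_ Hr].
  unfold R_dist. eapply Rle_lt_trans; [|exact Heps].
  rewrite varLL_moments by exact Hx.
  set (m := Eseq d Q n x (fun z => L x z * L x z)).
  set (mu := Eseq d Q n x (L x)).
  set (r := sqrt (INR n)) in *.
  assert (Hr1 : 1 <= r).
  { unfold r. rewrite <- sqrt_1. apply sqrt_le_1_alt. replace 1 with (INR 1) by reflexivity.
    now apply le_INR. }
  assert (Hrr : INR n = r * r) by (unfold r; rewrite sqrt_sqrt; [reflexivity|apply pos_INR]).
  assert (Hm0 : 0 <= m).
  { rewrite <- (Eseq_const n x 0 Hx). apply Eseq_le; [exact Hx|]. intros. apply Rle_0_sqr. }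
  assert (Hmu : Rabs mu <= 2 * B).
  { pose proof (first_moment n x Hx) as Hf. rewrite Eseq_plus in Hf. fold mu in Hf.
    replace mu with (h x + -1 * Eseq d Q n x (fun z => h (endpoint x z))) by lra.
    eapply Rle_trans; [apply Rabs_triang|]. rewrite Rabs_mult.
    replace (Rabs (-1)) with 1 by (rewrite Rabs_left; lra).
    assert (Rabs (Eseq d Q n x (fun z => h (endpoint x z))) <= B).
    { eapply Rle_trans; [apply Eseq_abs_le; exact Hx|]. rewrite <- (Eseq_const n x B Hx).
      apply Eseq_le; [exact Hx|]. intros z Hz _. apply Hbh. now apply (endpoint_lt d n). }
    specialize (Hbh x Hx). lra. }
  assert (Hdiff : Rabs (m - r * r * s2) <= 4 * B + B * (m / r + r)).
  { pose proof (second_moment n x Hx) as Hs. rewrite Hrr in Hs.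
    replace (m - r * r * s2) with ((m - Eseq d Q n x (fun z => L x z * L x z
      + 2 * h (endpoint x z) * L x z + 2 * w (endpoint x z))) + 2 * w x) by lra.
    eapply Rle_trans; [apply Rabs_triang|].
    rewrite (Rabs_mult 2), (Rabs_pos_eq 2) by lra.
    assert (Rabs (m - Eseq d Q n x (fun z => L x z * L x z
      + 2 * h (endpoint x z) * L x z + 2 * w (endpoint x z))) <= 2 * B + B * (m / r + r)).
    2:{ specialize (Hbw x Hx). lra. }
    replace (m - Eseq d Q n x (fun z => L x z * L x z
      + 2 * h (endpoint x z) * L x z + 2 * w (endpoint x z)))
      with (-1 * Eseq d Q n x (fun z => 2 * h (endpoint x z) * L x z + 2 * w (endpoint x z))).
    2:{ unfold m. rewrite !Eseq_plus. ring. }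
    rewrite Rabs_mult. replace (Rabs (-1)) with 1 by (rewrite Rabs_left; lra).
    rewrite Rmult_1_l. eapply Rle_trans; [apply Eseq_abs_le; exact Hx|].
    replace (2 * B + B * (m / r + r))
      with (Eseq d Q n x (fun z => (2 * B + B * r) + B / r * (L x z * L x z))).
    2:{ rewrite Eseq_plus, Eseq_scal, Eseq_const by exact Hx. fold m. field. lra. }
    apply Eseq_le; [exact Hx|]. intros z Hz _.
    assert (He' : (endpoint x z < d)%nat) by now apply (endpoint_lt d n).
    specialize (Hbh _ He'). specialize (Hbw _ He').
    eapply Rle_trans; [apply Rabs_triang|]. rewrite !Rabs_mult, (Rabs_pos_eq 2) by lra.
    (* AM-GM: [2 |L| <= r + L^2 / r] *)
    assert (HL : 2 * Rabs (L x z) <= r + / r * (L x z * L x z)).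
    { replace (L x z * L x z) with (Rabs (L x z) * Rabs (L x z))
        by (rewrite <- Rabs_mult; apply Rabs_pos_eq, Rle_0_sqr).
      set (u := Rabs (L x z)).
      assert (0 <= / r * ((u - r) * (u - r))).
      { apply Rmult_le_pos; [left; apply Rinv_0_lt_compat; lra|apply Rle_0_sqr]. }
      replace (/ r * ((u - r) * (u - r))) with (/ r * (u * u) - 2 * u + r) in * by (field; lra).
      lra. }
    pose proof (Rabs_pos (L x z)) as HL0. pose proof (Rabs_pos (h (endpoint x z))).
    assert (Rabs (h (endpoint x z)) * (2 * Rabs (L x z)) <= B * (r + / r * (L x z * L x z))).
    { apply Rmult_le_compat; lra. }
    unfold Rdiv. lra. }
  assert (HmK : m <= K * (r * r)).
  { assert (Hmr : B * (m / r) <= m / 2).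
    { apply (Rmult_le_reg_r r); [lra|]. replace (B * (m / r) * r) with (B * m) by (field; lra).
      assert (m * (2 * B) <= m * r) by (apply Rmult_le_compat_l; lra). lra. }
    assert (m - r * r * s2 <= 4 * B + B * (m / r + r)) by (eapply Rle_trans; [apply Rle_abs|exact Hdiff]).
    assert (r * r * s2 <= r * r * Rabs s2) by (apply Rmult_le_compat_l; [nra|apply Rle_abs]).
    assert (r <= r * r) by nra. assert (B * r <= B * (r * r)) by (apply Rmult_le_compat_l; lra).
    assert (B <= B * (r * r)) by nra.
    unfold K. nra. }
  assert (Hmr : m / r <= K * r).
  { apply (Rmult_le_reg_r r); [lra|]. replace (m / r * r) with m by (field; lra). lra. }
  rewrite Hrr.
  replace ((m - Rsqr mu) / (r * r) - s2) with (((m - r * r * s2) + - Rsqr mu) * / (r * r)) by (field; lra).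
  rewrite Rabs_mult, (Rabs_pos_eq (/ (r * r))).
  2:{ left. apply Rinv_0_lt_compat. nra. }
  replace (C / r) with ((C * r) * / (r * r)) by (field; lra).
  apply Rmult_le_compat_r; [left; apply Rinv_0_lt_compat; nra|].
  eapply Rle_trans; [apply Rabs_triang|]. rewrite Rabs_Ropp, (Rabs_pos_eq (Rsqr mu)) by apply Rle_0_sqr.
  assert (Rsqr mu <= 4 * (B * B)).
  { replace (4 * (B * B)) with (Rsqr (2 * B)) by (unfold Rsqr; ring). apply Rsqr_le_abs_1. rewrite (Rabs_pos_eq (2 * B)); lra. }
  assert (B * (m / r) <= B * (K * r)) by (apply Rmult_le_compat_l; lra).
  assert (0 <= B * B) by nra.
  unfold C. nra.
Qed.
End Variance.
End Expectation.

(** * The Gaussian distribution function *)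

Lemma phi_continuous x : continuous phi x.
Proof. apply continuity_pt_filterlim, phi_cont. Qed.

Lemma phi_ex_RInt a b : ex_RInt phi a b.
Proof. apply (ex_RInt_continuous (V := R_CompleteNormedModule)). intros; apply phi_continuous. Qed.

Lemma G_RInt x : G x = / 2 + RInt phi 0 x.
Proof. unfold G. now rewrite <- RInt_Reals. Qed.

Lemma G_derive x : is_derive G x (phi x).
Proof.
  apply is_derive_ext with (fun x => / 2 + RInt phi 0 x); [intros; symmetry; apply G_RInt|].
  rewrite <- (Rplus_0_l (phi x)).
  apply (is_derive_plus (V := R_NormedModule) (fun _ => / 2)); [apply @is_derive_const|].
  apply (is_derive_RInt (V := R_NormedModule)) with (a := 0); [|apply phi_continuous].
  exists (mkposreal 1 Rlt_0_1). intros y _. apply (RInt_correct (V := R_CompleteNormedModule)), phi_ex_RInt.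
Qed.

Lemma sqrt_2PI_ge_1 : 1 <= sqrt (2 * PI).
Proof. rewrite <- sqrt_1. apply sqrt_le_1_alt. pose proof PI2_1. unfold PI2 in *. lra. Qed.

Lemma phi_pos x : 0 < phi x.
Proof.
  unfold phi. apply Rmult_lt_0_compat; [apply exp_pos|].
  apply Rinv_0_lt_compat. pose proof sqrt_2PI_ge_1. lra.
Qed.

Lemma phi_derive x : is_derive phi x (- x * phi x).
Proof. unfold phi. auto_derive; [exact I|]. unfold Rdiv. field. pose proof sqrt_2PI_ge_1. lra. Qed.

(** With u = exp (x^2/4) >= 1 + x^2/4, both 1 <= u^2 and x^4 <= 16 u^2, whence 17. This one bound
    serves every polynomial of degree at most 4 times [phi], and also the Lipschitz constant of
    [G]. *)
Lemma phi_quartic_bound x : (1 + x ^ 4) * phi x <= 17.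
Proof.
  unfold phi.
  assert (He : exp (- (x * x) / 2) = / (exp (x * x / 4) * exp (x * x / 4))).
  { rewrite <- exp_plus, <- exp_Ropp. f_equal. field. }
  pose proof (exp_ineq1_le (x * x / 4)) as Hx. pose proof sqrt_2PI_ge_1 as Hs.
  assert (0 <= x * x) by apply Rle_0_sqr.
  set (u := exp (x * x / 4)) in *. set (r := sqrt (2 * PI)) in *.
  rewrite He. rewrite <- Rmult_assoc.
  assert (1 + x ^ 4 <= 17 * (u * u)).
  { assert ((1 + x * x / 4) * (1 + x * x / 4) <= u * u) by (apply Rmult_le_compat; lra).
    replace (x ^ 4) with ((x * x) * (x * x)) by ring. nra. }
  assert (1 <= u * u) by nra.
  apply (Rmult_le_reg_r (u * u * r)); [nra|].
  replace ((1 + x ^ 4) * / (u * u) * / r * (u * u * r)) with (1 + x ^ 4) by (field; split; nra).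
  nra.
Qed.

Lemma phi_le_17 x : phi x <= 17.
Proof.
  pose proof (phi_quartic_bound x). pose proof (phi_pos x).
  assert (0 <= x ^ 4) by (replace (x ^ 4) with (Rsqr (x * x)) by (unfold Rsqr; ring); apply Rle_0_sqr). nra.
Qed.

Lemma G_increasing x y : x < y -> G x < G y.
Proof.
  intros H. destruct (MVT_gen G x y phi) as (c & _ & E).
  - intros; apply G_derive.
  - intros z _. apply continuity_pt_filterlim, (ex_derive_continuous (V := R_NormedModule)).
    eexists; apply G_derive.
  - pose proof (phi_pos c). nra.
Qed.

Lemma G_monotone x y : x <= y -> G x <= G y.
Proof. intros [H| ->]; [left; now apply G_increasing|lra]. Qed.

Lemma G_lipschitz x y : Rabs (G y - G x) <= 17 * Rabs (y - x).
Proof.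
  destruct (MVT_gen G x y phi) as (c & _ & ->).
  - intros; apply G_derive.
  - intros z _. apply continuity_pt_filterlim, (ex_derive_continuous (V := R_NormedModule)).
    eexists; apply G_derive.
  - rewrite Rabs_mult. apply Rmult_le_compat_r; [apply Rabs_pos|].
    rewrite Rabs_pos_eq; [apply phi_le_17|left; apply phi_pos].
Qed.

(* Classical evaluation: [(int_0^x e^{-t^2/2})^2 / 2 + int_0^1 e^{-x^2(1+t^2)/2} / (1+t^2) dt]
   has zero derivative in [x], and equals [PI/4] at [x = 0]. *)
Definition gauss_aux (x t : R) : R := exp (- (x * x) * (1 + t * t) / 2) / (1 + t * t).

Lemma gauss_aux_derive x t :
  is_derive (fun u => gauss_aux u t) x (- x * exp (- (x * x) * (1 + t * t) / 2)).
Proof.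
  assert (0 <= t * t) by apply Rle_0_sqr.
  unfold gauss_aux. auto_derive; [exact I|]. unfold Rdiv. field. lra.
Qed.

Lemma gauss_aux_continuous x t : continuous (gauss_aux x) t.
Proof.
  assert (0 <= t * t) by apply Rle_0_sqr.
  apply (ex_derive_continuous (V := R_NormedModule)). unfold gauss_aux. auto_derive. lra.
Qed.

Lemma gauss_aux_ex_RInt x : ex_RInt (gauss_aux x) 0 1.
Proof. apply (ex_RInt_continuous (V := R_CompleteNormedModule)). intros; apply gauss_aux_continuous. Qed.

Definition gexp (t : R) : R := exp (- (t * t) / 2).

Lemma gexp_ex_RInt a b : ex_RInt gexp a b.
Proof.
  apply (ex_RInt_continuous (V := R_CompleteNormedModule)). intros. apply (ex_derive_continuous (V := R_NormedModule)).
  unfold gexp. auto_derive. exact I.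
Qed.

Lemma RInt_gexp_derive x : is_derive (RInt gexp 0) x (gexp x).
Proof.
  apply (is_derive_RInt (V := R_NormedModule)) with (a := 0).
  - exists (mkposreal 1 Rlt_0_1). intros y _. apply (RInt_correct (V := R_CompleteNormedModule)), gexp_ex_RInt.
  - apply (ex_derive_continuous (V := R_NormedModule)). unfold gexp. auto_derive. exact I.
Qed.

Lemma RInt_gauss_aux_derive x :
  is_derive (fun u => RInt (gauss_aux u) 0 1) x (- gexp x * RInt gexp 0 x).
Proof.
  assert (E : RInt (fun t => Derive (fun u => gauss_aux u t) x) 0 1 = - gexp x * RInt gexp 0 x).
  (* The integrand factors as [- gexp x] times [x * gexp (x * t)]; the substitution s = x t turns
     the second factor into an integral from 0 to x. *)
  { rewrite (RInt_ext (V := R_CompleteNormedModule) _ (fun t => scal (- gexp x) (scal x (gexp (x * t + 0))))).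
    - rewrite (RInt_scal (V := R_CompleteNormedModule)).
      + rewrite (RInt_comp_lin (V := R_CompleteNormedModule)) by apply gexp_ex_RInt.
        change (- gexp x * RInt gexp (x * 0 + 0) (x * 1 + 0) = - gexp x * RInt gexp 0 x).
        do 2 f_equal; ring.
      + apply (ex_RInt_comp_lin (V := R_NormedModule)), gexp_ex_RInt.
    - intros t _. etransitivity; [apply is_derive_unique, gauss_aux_derive|].
      change (- x * exp (- (x * x) * (1 + t * t) / 2) = - gexp x * (x * gexp (x * t + 0))).
      unfold gexp. transitivity (- x * (exp (- (x * x) / 2) * exp (- ((x * t + 0) * (x * t + 0)) / 2))); [|ring].
      rewrite <- exp_plus. do 2 f_equal. field. }
  rewrite <- E. apply is_derive_RInt_param.
  - exists (mkposreal 1 Rlt_0_1). intros y _ t _. eexists; apply gauss_aux_derive.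
  - intros t _.
    apply continuity_2d_pt_ext with (fun u v => - u * exp (- (u * u) * (1 + v * v) / 2)).
    { intros u v. symmetry. apply is_derive_unique, gauss_aux_derive. }
    apply continuity_2d_pt_mult; [apply continuity_2d_pt_opp, continuity_2d_pt_id1|].
    apply (continuity_1d_2d_pt_comp exp (fun u v => - (u * u) * (1 + v * v) / 2)).
    + apply derivable_continuous_pt, derivable_pt_exp.
    + unfold Rdiv. apply continuity_2d_pt_mult; [|apply continuity_2d_pt_const].
      apply continuity_2d_pt_mult.
      * apply continuity_2d_pt_opp, continuity_2d_pt_mult; apply continuity_2d_pt_id1.
      * apply continuity_2d_pt_plus; [apply continuity_2d_pt_const|].
        apply continuity_2d_pt_mult; apply continuity_2d_pt_id2.
  - exists (mkposreal 1 Rlt_0_1). intros y _. apply gauss_aux_ex_RInt.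
Qed.

Lemma RInt_gauss_aux_0 : RInt (gauss_aux 0) 0 1 = PI / 4.
Proof.
  apply is_RInt_unique.
  replace (PI / 4) with (atan 1 - atan 0) by (rewrite atan_1, atan_0; ring).
  apply is_RInt_ext with (fun t => / (1 + t ^ 2)).
  - intros t _. unfold gauss_aux. replace (- (0 * 0) * (1 + t * t) / 2) with 0 by field.
    rewrite exp_0. replace (1 + t * t) with (1 + t ^ 2) by ring. unfold Rdiv. now rewrite Rmult_1_l.
  - apply (is_RInt_derive (V := R_CompleteNormedModule) atan (fun t => / (1 + t ^ 2))).
    + intros t _. apply is_derive_Reals, derivable_pt_lim_atan.
    + intros t _. apply (ex_derive_continuous (V := R_NormedModule)). auto_derive.
      pose proof (Rle_0_sqr t) as Ht. unfold Rsqr in Ht. lra.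
Qed.

Lemma gauss_identity x : (RInt gexp 0 x) ^ 2 / 2 + RInt (gauss_aux x) 0 1 = PI / 4.
Proof.
  set (F := fun x => (RInt gexp 0 x) ^ 2 / 2 + RInt (gauss_aux x) 0 1).
  assert (HF : forall x, is_derive F x 0).
  { intros y.
    assert (D : is_derive F y (gexp y * RInt gexp 0 y + - gexp y * RInt gexp 0 y)).
    2:{ replace (gexp y * RInt gexp 0 y + - gexp y * RInt gexp 0 y) with 0 in D by ring. exact D. }
    unfold F. apply (is_derive_plus (V := R_NormedModule)); [|apply RInt_gauss_aux_derive].
    pose proof (RInt_gexp_derive y) as D. set (I := RInt gexp 0) in *.
    auto_derive; [eexists; exact D|].
    apply is_derive_unique in D. change (Derive (fun x => I x) y = gexp y) in D. rewrite D. field. }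
  change (F x = PI / 4).
  destruct (MVT_gen F 0 x (fun _ => 0)) as (c & _ & E).
  - intros; apply HF.
  - intros z _. apply continuity_pt_filterlim, (ex_derive_continuous (V := R_NormedModule)).
    eexists; apply HF.
  - replace (F x) with (F 0) by lra. unfold F. rewrite RInt_gauss_aux_0, RInt_point.
    change (@zero _) with 0. field.
Qed.

(** The auxiliary integral vanishes at infinity, so [gauss_identity] yields the Gaussian integral as
    a limit. *)
Lemma RInt_gauss_aux_bounds x : 0 <= RInt (gauss_aux x) 0 1 <= gexp x.
Proof.
  assert (Hb : forall t, 0 <= gauss_aux x t <= gexp x).
  { intros t. unfold gauss_aux, gexp. assert (0 <= t * t) by apply Rle_0_sqr.
    assert (0 <= x * x) by apply Rle_0_sqr.
    pose proof (exp_pos (- (x * x) * (1 + t * t) / 2)).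
    assert (exp (- (x * x) * (1 + t * t) / 2) <= exp (- (x * x) / 2)).
    { destruct (Req_dec (x * x * (t * t)) 0) as [E|E].
      - right. f_equal. replace (- (x * x) * (1 + t * t) / 2) with (- (x * x) / 2 - x * x * (t * t) / 2) by field.
        rewrite E. field.
      - left. apply exp_increasing. assert (0 <= x * x * (t * t)) by (apply Rmult_le_pos; lra). lra. }
    assert (0 < / (1 + t * t) <= 1).
    { split; [apply Rinv_0_lt_compat; lra|]. rewrite <- Rinv_1. apply Rinv_le_contravar; lra. }
    unfold Rdiv. split; [apply Rmult_le_pos; lra|].
    rewrite <- (Rmult_1_r (exp (- (x * x) */ 2))). apply Rmult_le_compat; unfold Rdiv in *; lra. }
  split.
  - apply RInt_ge_0; [lra|apply gauss_aux_ex_RInt|]. intros; apply Hb.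
  - replace (gexp x) with (RInt (fun _ => gexp x) 0 1).
    + apply RInt_le; [lra|apply gauss_aux_ex_RInt|apply ex_RInt_const|]. intros; apply Hb.
    + rewrite RInt_const. change ((1 - 0) * gexp x = gexp x). ring.
Qed.

Lemma G_gexp x : G x = / 2 + RInt gexp 0 x / sqrt (2 * PI).
Proof.
  rewrite G_RInt. f_equal.
  rewrite (RInt_ext (V := R_CompleteNormedModule) phi (fun t => scal (/ sqrt (2 * PI)) (gexp t))).
  - rewrite (RInt_scal (V := R_CompleteNormedModule)) by apply gexp_ex_RInt.
    change (/ sqrt (2 * PI) * RInt gexp 0 x = RInt gexp 0 x / sqrt (2 * PI)). unfold Rdiv. ring.
  - intros t _. change (phi t = / sqrt (2 * PI) * gexp t). unfold phi, gexp. ring.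
Qed.

(** The range of [G], its symmetry and its limits are all read off this identity, without improper
    integrals. *)
Lemma G_square x : 4 * ((G x - / 2) * (G x - / 2)) = 1 - 4 * RInt (gauss_aux x) 0 1 / PI.
Proof.
  pose proof (gauss_identity x) as E. pose proof PI_RGT_0.
  rewrite G_gexp. set (I := RInt gexp 0 x) in *. set (J := RInt (gauss_aux x) 0 1) in *.
  assert (Hs : sqrt (2 * PI) * sqrt (2 * PI) = 2 * PI) by (apply sqrt_sqrt; lra).
  pose proof sqrt_2PI_ge_1. set (r := sqrt (2 * PI)) in *.
  replace (4 * ((/ 2 + I / r - / 2) * (/ 2 + I / r - / 2))) with (4 * (I * I) / (r * r)) by (field; lra).
  rewrite Hs. replace (I * I) with (2 * (PI / 4 - J)) by (rewrite <- E; field). field. lra.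
Qed.

Lemma G_0 : G 0 = / 2.
Proof. rewrite G_RInt, RInt_point. change (@zero _) with 0. ring. Qed.

(** The right side of [G_square] is even in [x], so [G x - 1/2] and [G (- x) - 1/2] have equal
    squares; monotonicity around [G 0 = 1/2] gives them opposite signs. *)
Lemma G_symmetric x : G (- x) = 1 - G x.
Proof.
  assert (Hpos : forall y, 0 <= y -> G (- y) = 1 - G y).
  { intros y Hy. pose proof (G_monotone 0 y Hy). pose proof (G_monotone (- y) 0 ltac:(lra)).
    rewrite G_0 in *.
    assert (E : (G y - / 2) * (G y - / 2) = (G (- y) - / 2) * (G (- y) - / 2)).
    { apply (Rmult_eq_reg_l 4); [|lra]. rewrite !G_square. unfold gauss_aux.
      now replace (- y * - y) with (y * y) by ring. }
    nra. }
  destruct (Rle_dec 0 x) as [h|h]; [auto|].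
  specialize (Hpos (- x) ltac:(lra)). rewrite Ropp_involutive in Hpos. lra.
Qed.

Lemma G_upper x : G x <= 1.
Proof.
  pose proof (G_square x) as E. pose proof (RInt_gauss_aux_bounds x) as [B _].
  pose proof PI_RGT_0.
  assert (0 <= 4 * RInt (gauss_aux x) 0 1 / PI)
    by (apply Rmult_le_pos; [lra|left; now apply Rinv_0_lt_compat]).
  nra.
Qed.

Lemma G_lower x : 0 <= G x.
Proof. pose proof (G_upper (- x)) as Hu. rewrite G_symmetric in Hu. lra. Qed.

Lemma G_tends_to_1 eps : 0 < eps -> exists X, 0 < X /\ forall x, X <= x -> 1 - eps <= G x.
Proof.
  (* Then x >= 1, so x^2/2 >= x/2 >= 1/eps and [gexp x <= eps]. At the end, g = G x - 1/2 lies in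
     [0, 1/2], where 4 g^2 <= 2 g, so [G_square] gives 2 g >= 1 - 2 eps. *)
  intros He. exists (2 / eps + 1).
  assert (0 < 2 / eps) by (apply Rmult_lt_0_compat; [lra|now apply Rinv_0_lt_compat]).
  split; [lra|]. intros x Hx.
  pose proof (G_square x) as E. pose proof (RInt_gauss_aux_bounds x) as [B0 B].
  pose proof (G_monotone 0 x ltac:(lra)) as Hm. rewrite G_0 in Hm.
  assert (Hg : gexp x <= eps).
  { unfold gexp. pose proof (exp_ineq1_le (x * x / 2)) as Hi.
    replace (- (x * x) / 2) with (- (x * x / 2)) by field. rewrite exp_Ropp.
    assert (x <= x * x) by nra.
    assert (/ eps <= exp (x * x / 2)) by (unfold Rdiv in *; lra).
    rewrite <- (Rinv_inv eps). apply Rinv_le_contravar; [now apply Rinv_0_lt_compat|assumption]. }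
  assert (HPI : 2 <= PI) by (pose proof PI2_1; unfold PI2 in *; lra).
  assert (RInt (gauss_aux x) 0 1 / PI <= eps / 2).
  { apply Rmult_le_compat; [lra|left; apply Rinv_0_lt_compat; lra|lra|apply Rinv_le_contravar; lra]. }
  set (J := RInt (gauss_aux x) 0 1) in *.
  replace (4 * J / PI) with (4 * (J / PI)) in E by (unfold Rdiv; ring).
  pose proof (G_upper x).
  nra.
Qed.

(** * The central limit theorem *)

(** The bound on [e - a] lets the mean value theorem be iterated for Taylor remainders, with [a] and
    [b] in either order. The remainders lose their factorials, which is harmless: only the power of
    [b - a] matters. *)
Lemma segment_MVT (f f1 : R -> R) a b :
  (forall x, Rmin a b <= x <= Rmax a b -> is_derive f x (f1 x)) ->
  exists e, Rmin a b <= e <= Rmax a b /\ Rabs (e - a) <= Rabs (b - a) /\ f b - f a = f1 e * (b - a).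
Proof.
  intros Df. destruct (MVT_gen f a b f1) as (e & He & E).
  - intros x Hx. apply Df. lra.
  - intros x Hx. apply continuity_pt_filterlim, (ex_derive_continuous (V := R_NormedModule)).
    eexists. now apply Df.
  - exists e. split; [exact He|]. split; [|exact E].
    revert He. unfold Rmin, Rmax, Rabs.
    repeat (destruct (Rle_dec _ _) || destruct (Rcase_abs _)); lra.
Qed.

Lemma taylor1 f f1 a b M :
  (forall x, Rmin a b <= x <= Rmax a b -> is_derive f x (f1 x)) ->
  (forall x, Rmin a b <= x <= Rmax a b -> Rabs (f1 x) <= M) ->
  Rabs (f b - f a) <= M * Rabs (b - a).
Proof.
  intros Df HM. destruct (segment_MVT f f1 a b Df) as (e & He & _ & ->).
  rewrite Rabs_mult. apply Rmult_le_compat_r; [apply Rabs_pos|auto].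
Qed.

Lemma segment_trans a b c : Rmin a b <= c <= Rmax a b ->
  forall x, Rmin a c <= x <= Rmax a c -> Rmin a b <= x <= Rmax a b.
Proof.
  unfold Rmin, Rmax. intros H x.  revert H. repeat destruct (Rle_dec _ _); lra.
Qed.

Lemma taylor2 f f1 f2 a b M :
  (forall x, Rmin a b <= x <= Rmax a b -> is_derive f x (f1 x)) ->
  (forall x, Rmin a b <= x <= Rmax a b -> is_derive f1 x (f2 x)) ->
  (forall x, Rmin a b <= x <= Rmax a b -> Rabs (f2 x) <= M) ->
  Rabs (f b - f a - f1 a * (b - a)) <= M * Rabs (b - a) ^ 2.
Proof.
  intros Df Df1 HM.
  destruct (segment_MVT f f1 a b Df) as (e & He & Hea & ->).
  rewrite <- Rmult_minus_distr_r, Rabs_mult.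
  assert (H0 : Rabs (f1 e - f1 a) <= M * Rabs (e - a)).
  { apply (taylor1 f1 f2); intros x Hx; [apply Df1|apply HM]; now apply (segment_trans a b e). }
  assert (HM0 : 0 <= M) by (eapply Rle_trans; [apply Rabs_pos|apply (HM e He)]).
  pose proof (Rabs_pos (b - a)). replace (M * Rabs (b - a) ^ 2) with (M * Rabs (b - a) * Rabs (b - a)) by ring.
  apply Rmult_le_compat_r; [assumption|]. eapply Rle_trans; [exact H0|].
  now apply Rmult_le_compat_l.
Qed.

Lemma taylor3 f f1 f2 f3 a b M :
  (forall x, Rmin a b <= x <= Rmax a b -> is_derive f x (f1 x)) ->
  (forall x, Rmin a b <= x <= Rmax a b -> is_derive f1 x (f2 x)) ->
  (forall x, Rmin a b <= x <= Rmax a b -> is_derive f2 x (f3 x)) ->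
  (forall x, Rmin a b <= x <= Rmax a b -> Rabs (f3 x) <= M) ->
  Rabs (f b - f a - f1 a * (b - a) - f2 a * (b - a) ^ 2 / 2) <= M * Rabs (b - a) ^ 3.
Proof.
  intros Df Df1 Df2 HM.
  set (g := fun x => f x - f1 a * (x - a) - f2 a * (x - a) ^ 2 / 2).
  set (g1 := fun x => f1 x - f1 a - f2 a * (x - a)).
  assert (Dg : forall x, Rmin a b <= x <= Rmax a b -> is_derive g x (g1 x)).
  { intros x Hx. unfold g, g1. pose proof (Df x Hx) as D.
    auto_derive; [eexists; exact D|].
    apply is_derive_unique in D. change (Derive (fun x => f x) x = f1 x) in D. rewrite D. field. }
  destruct (segment_MVT g g1 a b Dg) as (e & He & Hea & E).
  replace (f b - f a - f1 a * (b - a) - f2 a * (b - a) ^ 2 / 2) with (g b - g a) by (unfold g; field).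
  rewrite E, Rabs_mult. unfold g1.
  assert (H0 : Rabs (f1 e - f1 a - f2 a * (e - a)) <= M * Rabs (e - a) ^ 2).
  { apply (taylor2 f1 f2 f3); intros x Hx; [apply Df1|apply Df2|apply HM]; now apply (segment_trans a b e). }
  assert (HM0 : 0 <= M) by (eapply Rle_trans; [apply Rabs_pos|apply (HM e He)]).
  pose proof (Rabs_pos (b - a)). replace (M * Rabs (b - a) ^ 3) with (M * Rabs (b - a) ^ 2 * Rabs (b - a)) by ring.
  apply Rmult_le_compat_r; [assumption|]. eapply Rle_trans; [exact H0|].
  apply Rmult_le_compat_l; [assumption|]. apply pow_incr. split; [apply Rabs_pos|assumption].
Qed.

(** For 1 <= j <= 4 this is (-1)^(j-1) He_(j-1) times [phi], with He the probabilists' Hermite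
    polynomials. The last branch is the fourth derivative, the highest one used. *)
Definition gderiv (j : nat) (x : R) : R :=
  match j with
  | 0%nat => G x
  | 1%nat => phi x
  | 2%nat => - x * phi x
  | 3%nat => (x * x - 1) * phi x
  | _ => (3 * x - x * x * x) * phi x
  end.

Lemma gderiv_derive j x : (j < 4)%nat -> is_derive (gderiv j) x (gderiv (S j) x).
Proof.
  intros Hj. pose proof (phi_derive x) as D. pose proof (is_derive_unique _ _ _ D) as U.
  change (Derive (fun x => phi x) x = - x * phi x) in U.
  destruct j as [|[|[|[|j]]]]; [apply G_derive|exact D| | |lia]; unfold gderiv;
    (auto_derive; [eexists; exact D|rewrite U; ring]).
Qed.

(** The Hermite recurrence, which turns the time derivative of [heat] into half its second space
    derivative. *)
Lemma gderiv_recurrence j x : (j <= 2)%nat ->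
  gderiv (S (S j)) x = - x * gderiv (S j) x - INR j * gderiv j x.
Proof. intros Hj. destruct j as [|[|[|j]]]; [| | |lia]; simpl; ring. Qed.

(** Each polynomial factor is at most 4 (1 + x^4), and 68 = 4 * 17. *)
Lemma gderiv_bound j x : (1 <= j <= 4)%nat -> Rabs (gderiv j x) <= 68.
Proof.
  intros Hj. pose proof (phi_quartic_bound x) as B. pose proof (phi_pos x) as Hp.
  assert (H : forall p, Rabs p <= 4 * (1 + x ^ 4) -> Rabs (p * phi x) <= 68).
  { intros p Hpl. rewrite Rabs_mult, (Rabs_pos_eq (phi x)) by lra. nra. }
  assert (H2 : 0 <= x * x) by apply Rle_0_sqr.
  assert (H4 : x ^ 4 = (x * x) * (x * x)) by ring.
  assert (Hx : Rabs x <= 1 + x ^ 4) by (pose proof (Rle_0_sqr (x * x - /2)); pose proof (Rle_0_sqr (x - / 2)); pose proof (Rle_0_sqr (x + / 2)); unfold Rsqr in *; rewrite H4; unfold Rabs; destruct (Rcase_abs x); lra).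
  assert (Hx3 : Rabs (x * x * x) <= 1 + x ^ 4).
  { rewrite Rabs_mult, (Rabs_pos_eq (x * x)) by lra.
    assert (E : x * x = Rabs x * Rabs x) by (rewrite <- Rabs_mult; symmetry; apply Rabs_pos_eq; lra).
    rewrite H4, E. set (u := Rabs x). assert (0 <= u) by apply Rabs_pos.
    destruct (Rle_dec u 1).
    - assert (u * u <= 1) by nra. assert (0 <= (u * u) * (u * u)) by nra.
      assert (u * u * u <= 1) by nra. lra.
    - assert (0 <= u * u * u) by (apply Rmult_le_pos; nra).
      assert (u * u * u * 1 <= u * u * u * u) by (apply Rmult_le_compat_l; lra). lra. }
  destruct j as [|[|[|[|[|j]]]]]; try lia; simpl gderiv.
  - rewrite <- (Rmult_1_l (phi x)). apply H. rewrite Rabs_R1. nra.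
  - apply H. rewrite Rabs_Ropp. nra.
  - apply H. unfold Rabs; destruct (Rcase_abs _); nra.
  - apply H. unfold Rminus. eapply Rle_trans; [apply Rabs_triang|].
    rewrite Rabs_Ropp, Rabs_mult, (Rabs_pos_eq 3) by lra. lra.
Qed.

(* [heat c 0] solves the heat equation [u_t = u_ss / 2] and tends to the indicator of [s >= c] as
   [t -> 0]; [heat c j] is its [j]-th space derivative for [j <= 4]. *)
Definition heat (c : R) (j : nat) (t s : R) : R := gderiv j ((s - c) / sqrt t) * (/ sqrt t) ^ j.

Lemma heat_derive_space c j t s : 0 < t -> (j < 4)%nat ->
  is_derive (heat c j t) s (heat c (S j) t s).
Proof.
  intros Ht Hj. unfold heat. pose proof (sqrt_lt_R0 t Ht) as Hr. set (r := sqrt t) in *.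
  pose proof (gderiv_derive j ((s - c) / r) Hj) as D.
  set (g := gderiv j) in *. set (g1 := gderiv (S j)) in *.
  auto_derive; [eexists; exact D|].
  apply is_derive_unique in D. change (Derive (fun x => g x) ((s - c) * / r) = g1 ((s - c) * / r)) in D.
  unfold Rminus in D. rewrite D. unfold Rdiv, Rminus. simpl. ring.
Qed.

Lemma heat_derive_time c j t s : 0 < t -> (j <= 2)%nat ->
  is_derive (fun t => heat c j t s) t (/ 2 * heat c (S (S j)) t s).
Proof.
  intros Ht Hj. pose proof (sqrt_lt_R0 t Ht) as Hr.
  pose proof (gderiv_derive j ((s - c) / sqrt t) ltac:(lia)) as D.
  unfold heat at 2. rewrite gderiv_recurrence by exact Hj. unfold heat.
  set (g := gderiv j) in *. set (g1 := gderiv (S j)) in *.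
  apply is_derive_unique in D as U.
  change (Derive (fun x => g x) ((s - c) * / sqrt t) = g1 ((s - c) * / sqrt t)) in U.
  auto_derive.
  - repeat split; try assumption; try lra. eexists; exact D.
  - rewrite U. unfold Rdiv, Rminus.
    assert (E : t = sqrt t * sqrt t) by (rewrite sqrt_sqrt; lra).
    set (r := sqrt t) in *. destruct j as [|j]; simpl pred; simpl pow; simpl INR; field; lra.
Qed.

Lemma heat_bound c del : 0 < del -> exists M, 0 <= M /\
  forall j t s, (1 <= j <= 4)%nat -> del <= t -> Rabs (heat c j t s) <= M.
Proof.
  intros Hd. pose proof (sqrt_lt_R0 del Hd) as Hr.
  (* The added 1 ensures q >= 1, so that q^4 dominates the scaling factor of every order j <= 4. *)
  set (q := 1 + / sqrt del).
  assert (Hq : 1 <= q) by (unfold q; pose proof (Rinv_0_lt_compat _ Hr); lra).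
  exists (68 * q ^ 4). split; [apply Rmult_le_pos; [lra|apply pow_le; lra]|].
  intros j t s Hj Ht. unfold heat. rewrite Rabs_mult.
  apply Rmult_le_compat; [apply Rabs_pos|apply Rabs_pos|now apply gderiv_bound|].
  assert (0 < / sqrt t <= q).
  { split; [apply Rinv_0_lt_compat, sqrt_lt_R0; lra|].
    unfold q. assert (/ sqrt t <= / sqrt del) by (apply Rinv_le_contravar; [exact Hr|now apply sqrt_le_1_alt]). lra. }
  rewrite Rabs_pos_eq by (apply pow_le; lra).
  apply Rle_trans with (q ^ j); [apply pow_incr; lra|].
  apply Rle_pow; [exact Hq|lia].
Qed.

(** * Approximate backward equation and convergence of tail probabilities *)

Section CLT.
Variables (d : nat) (Q : nat -> nat -> R).
Hypothesis (HQ : stochastic d Q).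
Variables (H s2 : R) (h w : nat -> R).
Let ell := infdev Q H.
Hypothesis Hs2 : 0 < s2.
Hypothesis Hh : forall x, (x < d)%nat ->
  sumR (seq 0 d) (fun y => Q y x * (ell x y + h y)) = h x.
Hypothesis Hw : forall x, (x < d)%nat ->
  sumR (seq 0 d) (fun y => Q y x * (ell x y * ell x y / 2 + h y * ell x y + w y)) = w x + s2 / 2.

(** Two-scale ansatz with [k] steps to go, for the path sum scaled by [eps]: each remaining step
    adds [s2 * eps^2] to the clock. [h] cancels the order [eps], and [w] replaces the
    state-dependent local variance by the constant [s2]. *)
Definition corrected (c del eps : R) (k x : nat) (s : R) : R :=
  heat c 0 (del + s2 * INR k * eps ^ 2) s
  + eps * h x * heat c 1 (del + s2 * INR k * eps ^ 2) s
  + eps ^ 2 * w x * heat c 2 (del + s2 * INR k * eps ^ 2) s.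

(** The three terms are expanded to orders 2, 1 and 0 in the increment, so with their prefactors
    every remainder is of order eps^3. The coefficients that appear, l + hy and l^2/2 + hy l + wy,
    are the quantities averaged by [Hh] and [Hw]. *)
Lemma space_expansion c del M K eps t s l hy wy : 0 < del -> del <= t -> 0 <= eps <= 1 ->
  (forall j t s, (1 <= j <= 4)%nat -> del <= t -> Rabs (heat c j t s) <= M) ->
  Rabs l <= K -> Rabs hy <= K -> Rabs wy <= K ->
  Rabs (heat c 0 t (s + eps * l) + eps * hy * heat c 1 t (s + eps * l) + eps ^ 2 * wy * heat c 2 t (s + eps * l)
   - (heat c 0 t s + eps * heat c 1 t s * (l + hy) + eps ^ 2 * heat c 2 t s * (l * l / 2 + hy * l + wy)))
  <= eps ^ 3 * (M * (2 * K ^ 3 + K ^ 2)).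
Proof.
  intros Hd Ht He HM Hl Hhy Hwy.
  assert (HD : forall j x, (j < 4)%nat -> is_derive (heat c j t) x (heat c (S j) t x))
    by (intros; apply heat_derive_space; [lra|assumption]).
  assert (HM0 : 0 <= M) by (eapply Rle_trans; [apply Rabs_pos|apply (HM 1%nat t s); [lia|lra]]).
  pose proof (Rabs_pos l) as Hl0.
  assert (E1 : Rabs (eps * l) = eps * Rabs l) by (rewrite Rabs_mult, (Rabs_pos_eq eps); lra).
  pose proof (taylor3 (heat c 0 t) (heat c 1 t) (heat c 2 t) (heat c 3 t) s (s + eps * l) M) as T3.
  pose proof (taylor2 (heat c 1 t) (heat c 2 t) (heat c 3 t) s (s + eps * l) M) as T2.
  pose proof (taylor1 (heat c 2 t) (heat c 3 t) s (s + eps * l) M) as T1.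
  replace (s + eps * l - s) with (eps * l) in T1, T2, T3 by ring.
  rewrite E1 in T1, T2, T3.
  assert (T3' := T3 (fun x _ => HD 0%nat x ltac:(lia)) (fun x _ => HD 1%nat x ltac:(lia))
    (fun x _ => HD 2%nat x ltac:(lia)) (fun x _ => HM 3%nat t x ltac:(lia) Ht)).
  assert (T2' := T2 (fun x _ => HD 1%nat x ltac:(lia))
    (fun x _ => HD 2%nat x ltac:(lia)) (fun x _ => HM 3%nat t x ltac:(lia) Ht)).
  assert (T1' := T1 (fun x _ => HD 2%nat x ltac:(lia)) (fun x _ => HM 3%nat t x ltac:(lia) Ht)).
  clear T1 T2 T3.
  cbv beta in T1', T2', T3'.
  set (R3 := heat c 0 t (s + eps * l) - heat c 0 t s - heat c 1 t s * (eps * l) - heat c 2 t s * (eps * l) ^ 2 / 2) in *.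
  set (R2 := heat c 1 t (s + eps * l) - heat c 1 t s - heat c 2 t s * (eps * l)) in *.
  set (R1 := heat c 2 t (s + eps * l) - heat c 2 t s) in *.
  match goal with |- Rabs ?u <= _ => replace u with (R3 + eps * hy * R2 + eps ^ 2 * wy * R1)
    by (unfold R1, R2, R3; field) end.
  assert (Hk : eps * Rabs l <= eps * K) by (apply Rmult_le_compat_l; lra).
  assert (Hk0 : 0 <= eps * Rabs l) by (apply Rmult_le_pos; lra).
  assert (HK0 : 0 <= K) by lra.
  assert (B3 : Rabs R3 <= M * (eps * K) ^ 3).
  { eapply Rle_trans; [exact T3'|]. apply Rmult_le_compat_l; [exact HM0|]. apply pow_incr; lra. }
  assert (B2 : Rabs (eps * hy * R2) <= eps * K * (M * (eps * K) ^ 2)).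
  { rewrite !Rabs_mult, (Rabs_pos_eq eps) by lra. pose proof (Rabs_pos hy).
    apply Rmult_le_compat; [nra|apply Rabs_pos|nra|].
    eapply Rle_trans; [exact T2'|]. apply Rmult_le_compat_l; [exact HM0|]. apply pow_incr; lra. }
  assert (B1 : Rabs (eps ^ 2 * wy * R1) <= eps ^ 2 * K * (M * (eps * K))).
  { assert (0 <= eps ^ 2) by (apply pow_le; lra).
    rewrite !Rabs_mult, (Rabs_pos_eq (eps ^ 2)) by lra. pose proof (Rabs_pos wy).
    apply Rmult_le_compat; [nra|apply Rabs_pos|nra|].
    eapply Rle_trans; [exact T1'|]. apply Rmult_le_compat_l; [exact HM0|]. lra. }
  eapply Rle_trans; [apply Rabs_triang|].
  eapply Rle_trans; [apply Rplus_le_compat_r, Rabs_triang|].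
  eapply Rle_trans; [apply Rplus_le_compat; [apply Rplus_le_compat; [exact B3|exact B2]|exact B1]|].
  right. ring.
Qed.

(** Advancing the clock by tau = s2 eps^2 changes u by (s2/2) eps^2 u_ss up to tau^2, which is
    exactly the excess [s2 / 2] in [Hw]. The correctors change only by O(tau), times at least one
    [eps]. *)
Lemma time_expansion c del M K eps t s hx wx : 0 < del -> del <= t -> 0 <= eps <= 1 ->
  (forall j t s, (1 <= j <= 4)%nat -> del <= t -> Rabs (heat c j t s) <= M) ->
  Rabs hx <= K -> Rabs wx <= K ->
  Rabs (heat c 0 t s + eps * heat c 1 t s * hx + eps ^ 2 * heat c 2 t s * (wx + s2 / 2)
    - (heat c 0 (t + s2 * eps ^ 2) s + eps * hx * heat c 1 (t + s2 * eps ^ 2) s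
       + eps ^ 2 * wx * heat c 2 (t + s2 * eps ^ 2) s))
  <= eps ^ 3 * (M * (s2 ^ 2 + 2 * K * s2)).
Proof.
  intros Hd Ht He HM Hhx Hwx.
  set (tau := s2 * eps ^ 2).
  assert (Htau : 0 <= tau) by (apply Rmult_le_pos; [lra|apply pow_le; lra]).
  assert (Hin : forall u, Rmin t (t + tau) <= u <= Rmax t (t + tau) -> del <= u).
  { intros u. rewrite Rmin_left by lra. lra. }
  assert (HM0 : 0 <= M) by (eapply Rle_trans; [apply Rabs_pos|apply (HM 1%nat t s); [lia|lra]]).
  assert (HD : forall j u, (j <= 2)%nat -> Rmin t (t + tau) <= u <= Rmax t (t + tau) ->
     is_derive (fun u => heat c j u s) u (/ 2 * heat c (S (S j)) u s)).
  { intros j u Hj Hu. apply heat_derive_time; [|assumption]. specialize (Hin u Hu). lra. }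
  assert (HB : forall j u, (1 <= j <= 4)%nat -> Rmin t (t + tau) <= u <= Rmax t (t + tau) ->
     Rabs (/ 2 * heat c j u s) <= M).
  { intros j u Hj Hu. rewrite Rabs_mult, (Rabs_pos_eq (/ 2)) by lra.
    specialize (HM j u s Hj (Hin u Hu)). pose proof (Rabs_pos (heat c j u s)). lra. }
  assert (T2 : Rabs (heat c 0 (t + tau) s - heat c 0 t s - / 2 * heat c 2 t s * tau) <= M * tau ^ 2).
  { replace tau with (t + tau - t) at 2 by ring.
    replace (tau ^ 2) with (Rabs (t + tau - t) ^ 2)
      by (replace (t + tau - t) with tau by ring; rewrite Rabs_pos_eq; auto).
    apply (taylor2 (fun u => heat c 0 u s) (fun u => / 2 * heat c 2 u s)
      (fun u => / 2 * (/ 2 * heat c 4 u s))).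
    - intros u Hu. apply HD; [lia|assumption].
    - intros u Hu. apply is_derive_scal, (HD 2%nat); [lia|assumption].
    - intros u Hu. rewrite Rabs_mult, (Rabs_pos_eq (/ 2)) by lra.
      specialize (HB 4%nat u ltac:(lia) Hu). pose proof (Rabs_pos (/ 2 * heat c 4 u s)). lra. }
  assert (T1 : forall j, (1 <= j <= 2)%nat -> Rabs (heat c j (t + tau) s - heat c j t s) <= M * tau).
  { intros j Hj. replace tau with (Rabs (t + tau - t)) at 2
      by (replace (t + tau - t) with tau by ring; apply Rabs_pos_eq; auto).
    apply (taylor1 (fun u => heat c j u s) (fun u => / 2 * heat c (S (S j)) u s)).
    - intros u Hu. apply HD; [lia|assumption].
    - intros u Hu. apply HB; [lia|assumption]. }
  pose proof (T1 1%nat ltac:(lia)) as T11. pose proof (T1 2%nat ltac:(lia)) as T12. clear T1.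
  set (R0 := heat c 0 (t + tau) s - heat c 0 t s - / 2 * heat c 2 t s * tau) in *.
  set (R1 := heat c 1 (t + tau) s - heat c 1 t s) in *.
  set (R2 := heat c 2 (t + tau) s - heat c 2 t s) in *.
  match goal with |- Rabs ?u <= _ => replace u with (- (R0 + eps * hx * R1 + eps ^ 2 * wx * R2))
    by (unfold R0, R1, R2, tau; field) end.
  rewrite Rabs_Ropp.
  assert (He2 : 0 <= eps ^ 2) by (apply pow_le; lra).
  assert (B1 : Rabs (eps * hx * R1) <= eps * K * (M * tau)).
  { rewrite !Rabs_mult, (Rabs_pos_eq eps) by lra. pose proof (Rabs_pos hx).
    apply Rmult_le_compat; [nra|apply Rabs_pos|nra|assumption]. }
  assert (B2 : Rabs (eps ^ 2 * wx * R2) <= eps ^ 2 * K * (M * tau)).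
  { rewrite !Rabs_mult, (Rabs_pos_eq (eps ^ 2)) by lra. pose proof (Rabs_pos wx).
    apply Rmult_le_compat; [nra|apply Rabs_pos|nra|assumption]. }
  eapply Rle_trans; [apply Rabs_triang|].
  eapply Rle_trans; [apply Rplus_le_compat_r, Rabs_triang|].
  eapply Rle_trans; [apply Rplus_le_compat; [apply Rplus_le_compat; [exact T2|exact B1]|exact B2]|].
  assert (HK : 0 <= K) by (eapply Rle_trans; [apply Rabs_pos|exact Hhx]).
  unfold tau.
  replace (M * (s2 * eps ^ 2) ^ 2 + eps * K * (M * (s2 * eps ^ 2)) + eps ^ 2 * K * (M * (s2 * eps ^ 2)))
    with (eps ^ 3 * (M * (eps * s2 ^ 2 + K * s2 + eps * (K * s2)))) by ring.
  apply Rmult_le_compat_l; [apply pow_le; lra|]. apply Rmult_le_compat_l; [exact HM0|].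
  assert (0 <= s2 ^ 2) by (apply pow_le; lra). assert (0 <= K * s2) by (apply Rmult_le_pos; lra). nra.
Qed.

Lemma corrected_step c del M K eps k x s : 0 < del -> 0 <= eps <= 1 ->
  (forall j t s, (1 <= j <= 4)%nat -> del <= t -> Rabs (heat c j t s) <= M) ->
  (forall x y, (x < d)%nat -> (y < d)%nat -> Rabs (ell x y) <= K /\ Rabs (h x) <= K /\ Rabs (w x) <= K) ->
  (x < d)%nat ->
  Rabs (sumR (seq 0 d) (fun y => Q y x * corrected c del eps k y (s + eps * ell x y))
        - corrected c del eps (S k) x s)
  <= eps ^ 3 * (M * (2 * K ^ 3 + K ^ 2)) + eps ^ 3 * (M * (s2 ^ 2 + 2 * K * s2)).
Proof.
  intros Hd He HM HK Hx. unfold corrected.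
  replace (del + s2 * INR (S k) * eps ^ 2) with (del + s2 * INR k * eps ^ 2 + s2 * eps ^ 2)
    by (rewrite S_INR; ring).
  set (t := del + s2 * INR k * eps ^ 2).
  assert (Ht : del <= t).
  { unfold t. assert (0 <= s2 * INR k * eps ^ 2); [|lra].
    apply Rmult_le_pos; [apply Rmult_le_pos; [lra|apply pos_INR]|apply pow_le; lra]. }
  (* The common value of both expansions: the average of the space expansion by [Hh] and [Hw], and
     the time expansion backwards from the later clock. *)
  set (main := heat c 0 t s + eps * heat c 1 t s * h x + eps ^ 2 * heat c 2 t s * (w x + s2 / 2)).
  match goal with |- Rabs (?S - ?T) <= _ => replace (S - T) with ((S - main) + (main - T)) by ring end.
  eapply Rle_trans; [apply Rabs_triang|]. apply Rplus_le_compat.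
  2:{ apply (time_expansion c del M K); try assumption; now apply (HK x x). }
  assert (Em : main = sumR (seq 0 d) (fun y => Q y x *
     (heat c 0 t s + eps * heat c 1 t s * (ell x y + h y)
      + eps ^ 2 * heat c 2 t s * (ell x y * ell x y / 2 + h y * ell x y + w y)))).
  { rewrite (sumR_ext _ _ (fun y => Q y x * heat c 0 t s
      + (eps * heat c 1 t s) * (Q y x * (ell x y + h y))
      + (eps ^ 2 * heat c 2 t s) * (Q y x * (ell x y * ell x y / 2 + h y * ell x y + w y)))) by (intros; ring).
    rewrite !sumR_plus, sumR_scal_r, !sumR_scal, Hh, Hw, (proj2 HQ) by exact Hx. unfold main. ring. }
  rewrite Em, <- sumR_minus. eapply Rle_trans; [apply sumR_abs_le|].
  set (err := eps ^ 3 * (M * (2 * K ^ 3 + K ^ 2))).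
  replace err with (sumR (seq 0 d) (fun y => Q y x * err))
    by (rewrite sumR_scal_r, (proj2 HQ x Hx); ring).
  apply sumR_seq_le. intros y Hy. rewrite <- Rmult_minus_distr_l, Rabs_mult.
  assert (Hq : 0 <= Q y x) by now apply HQ.
  rewrite (Rabs_pos_eq _ Hq). apply Rmult_le_compat_l; [exact Hq|].
  apply (space_expansion c del M K); try assumption; try (now apply (HK x y)); now apply (HK y y).
Qed.

Lemma smooth_CLT c del x : 0 < del -> (x < d)%nat -> exists C, forall n, (1 <= n)%nat ->
  Rabs (Eseq d Q n x (fun z => G ((path_sum ell x z / sqrt (INR n) - c) / sqrt del))
        - G (- c / sqrt (del + s2))) <= C / sqrt (INR n).
Proof.
  intros Hd Hx. destruct (heat_bound c del Hd) as (M & HM0 & HM).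
  assert (exists K, forall x y, (x < d)%nat -> (y < d)%nat ->
     Rabs (ell x y) <= K /\ Rabs (h x) <= K /\ Rabs (w x) <= K) as (K & HK).
  { destruct (finite_bound d h) as (K1 & HK1 & Hb1). destruct (finite_bound d w) as (K2 & HK2 & Hb2).
    exists (K1 + K2 + sumR (seq 0 d) (fun x => sumR (seq 0 d) (fun y => Rabs (ell x y)))).
    intros x0 y Hx0 Hy. specialize (Hb1 x0 Hx0). specialize (Hb2 x0 Hx0).
    assert (Rabs (ell x0 y) <= sumR (seq 0 d) (fun x => sumR (seq 0 d) (fun y => Rabs (ell x y)))).
    { apply Rle_trans with (sumR (seq 0 d) (fun y => Rabs (ell x0 y))).
      - apply (sumR_member_le _ (fun y => Rabs (ell x0 y))); [intros; apply Rabs_pos|now apply in_seq0].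
      - apply (sumR_member_le _ (fun x => sumR (seq 0 d) (fun y => Rabs (ell x y)))); [|now apply in_seq0].
        intros; apply sumR_nonneg; intros; apply Rabs_pos. }
    pose proof (Rabs_pos (ell x0 y)). lra. }
  set (C0 := M * (2 * K ^ 3 + K ^ 2) + M * (s2 ^ 2 + 2 * K * s2)).
  (* [C0] comes from n steps of error C0 eps^3 with eps = 1/sqrt n; removing the two correctors
     costs 2 eps K M at each end of the path. *)
  exists (C0 + 4 * (K * M)). intros n Hn.
  assert (Hr1 : 1 <= sqrt (INR n)).
  { rewrite <- sqrt_1. apply sqrt_le_1_alt. replace 1 with (INR 1) by reflexivity. now apply le_INR. }
  assert (Hrr : sqrt (INR n) * sqrt (INR n) = INR n) by (apply sqrt_sqrt, pos_INR).
  set (r := sqrt (INR n)) in *. set (eps := / r).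
  assert (He : 0 < eps <= 1).
  { split; [apply Rinv_0_lt_compat; lra|]. unfold eps. rewrite <- Rinv_1. apply Rinv_le_contravar; lra. }
  pose proof (Eseq_backward d Q HQ (corrected c del eps) (fun x y => eps * ell x y) (eps ^ 3 * C0) n) as Hb.
  specialize (fun Hs => Hb Hs n x 0 (le_n n) Hx).
  assert (Hstep : forall k x s, (k < n)%nat -> (x < d)%nat ->
     Rabs (sumR (seq 0 d) (fun y => Q y x * corrected c del eps k y (s + eps * ell x y))
        - corrected c del eps (S k) x s) <= eps ^ 3 * C0).
  { intros k x0 s _ Hx0. unfold C0. rewrite Rmult_plus_distr_l. apply corrected_step; auto. lra. }
  specialize (Hb Hstep).
  assert (HKM : forall j t s u, Rabs u <= K -> (1 <= j <= 4)%nat -> del <= t ->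
     forall e, 0 <= e <= eps -> Rabs (e * u * heat c j t s) <= eps * (K * M)).
  { intros j t s u Hu Hj Ht e He'. rewrite !Rabs_mult, (Rabs_pos_eq e), Rmult_assoc by lra.
    apply Rmult_le_compat; [lra|apply Rmult_le_pos; apply Rabs_pos|lra|].
    apply Rmult_le_compat; [apply Rabs_pos|apply Rabs_pos|assumption|auto]. }
  assert (Hcorr : forall k y s, (y < d)%nat ->
     Rabs (corrected c del eps k y s - heat c 0 (del + s2 * INR k * eps ^ 2) s) <= 2 * eps * (K * M)).
  { intros k y s Hy. unfold corrected. set (t := del + s2 * INR k * eps ^ 2).
    assert (Ht : del <= t).
    { unfold t. assert (0 <= s2 * INR k * eps ^ 2); [|lra].
      apply Rmult_le_pos; [apply Rmult_le_pos; [lra|apply pos_INR]|apply pow_le; lra]. }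
    destruct (HK y y Hy Hy) as (_ & Hky & Hwy).
    match goal with |- Rabs ?u <= _ => replace u with (eps * h y * heat c 1 t s + eps ^ 2 * w y * heat c 2 t s) by ring end.
    eapply Rle_trans; [apply Rabs_triang|].
    replace (2 * eps * (K * M)) with (eps * (K * M) + eps * (K * M)) by ring.
    apply Rplus_le_compat; apply HKM; try assumption; try lia; nra. }
  set (S0 := Eseq d Q n x (fun z => corrected c del eps 0 (endpoint x z) (0 + path_sum (fun x y => eps * ell x y) x z))) in *.
  match goal with |- Rabs (?e - ?g) <= _ => set (E0 := e); set (g0 := g) end.
  assert (H1 : Rabs (S0 - E0) <= 2 * eps * (K * M)).
  { apply Eseq_approx; [exact HQ|exact Hx|]. intros z Hz _.
    assert (Hez : (endpoint x z < d)%nat) by now apply (endpoint_lt d n).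
    specialize (Hcorr 0%nat (endpoint x z) (0 + path_sum (fun x y => eps * ell x y) x z) Hez).
    replace (del + s2 * INR 0 * eps ^ 2) with del in Hcorr by (simpl; ring).
    eapply Rle_trans; [|exact Hcorr]. right. do 2 f_equal.
    unfold heat, gderiv. rewrite path_sum_scal, pow_O, Rmult_1_r. f_equal.
    unfold eps, Rdiv. ring. }
  assert (H2 : Rabs (corrected c del eps n x 0 - g0) <= 2 * eps * (K * M)).
  { specialize (Hcorr n x 0 Hx).
    replace (del + s2 * INR n * eps ^ 2) with (del + s2) in Hcorr by (rewrite <- Hrr; unfold eps; field; lra).
    eapply Rle_trans; [|exact Hcorr]. right. do 2 f_equal. unfold g0, heat, gderiv.
    rewrite pow_O, Rmult_1_r. f_equal. unfold Rdiv. ring. }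
  replace (E0 - g0) with (- (S0 - E0) + (S0 - corrected c del eps n x 0) + (corrected c del eps n x 0 - g0)) by ring.
  eapply Rle_trans; [apply Rabs_triang|]. eapply Rle_trans; [apply Rplus_le_compat_r, Rabs_triang|].
  rewrite Rabs_Ropp.
  replace (INR n * (eps ^ 3 * C0)) with (eps * C0) in Hb by (rewrite <- Hrr; unfold eps; field; lra).
  replace ((C0 + 4 * (K * M)) / r) with (eps * C0 + 4 * eps * (K * M)) by (unfold eps; field; lra).
  lra.
Qed.

Definition tail_prob (n x : nat) (c : R) : R :=
  Eseq d Q n x (fun z => if Rle_dec (c * sqrt (INR n)) (- ln (Qseq Q x z) - INR n * H) then 1 else 0).

(** A step function lies between two smooth profiles shifted by [eta] to either side. Beyond the
    shift, a profile misses its limiting value 0 or 1 by at most [1 - G (eta / sqrt del)]. *)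
Lemma tail_smooth_bounds n x c eta del : (1 <= n)%nat -> (x < d)%nat -> 0 < del -> 0 < eta ->
  Eseq d Q n x (fun z => G ((path_sum ell x z / sqrt (INR n) - (c + eta)) / sqrt del)) - (1 - G (eta / sqrt del))
  <= tail_prob n x c
  <= Eseq d Q n x (fun z => G ((path_sum ell x z / sqrt (INR n) - (c - eta)) / sqrt del)) + (1 - G (eta / sqrt del)).
Proof.
  intros Hn Hx Hd Heta.
  assert (Hr1 : 1 <= sqrt (INR n)).
  { rewrite <- sqrt_1. apply sqrt_le_1_alt. replace 1 with (INR 1) by reflexivity. now apply le_INR. }
  pose proof (sqrt_lt_R0 del Hd) as Hsd. pose proof (Rinv_0_lt_compat _ Hsd) as Hid.
  unfold tail_prob. set (r := sqrt (INR n)) in *.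
  pose proof (G_upper (eta / sqrt del)) as Hu.
  assert (Hcase : forall z, valid d n z -> 0 < Qseq Q x z ->
     (c <= path_sum ell x z / r /\ (if Rle_dec (c * r) (- ln (Qseq Q x z) - INR n * H) then 1 else 0) = 1)
     \/ (path_sum ell x z / r < c /\ (if Rle_dec (c * r) (- ln (Qseq Q x z) - INR n * H) then 1 else 0) = 0)).
  { intros z Hz Hq. rewrite (log_Qseq d Q HQ H n x z Hx Hz Hq). fold ell.
    assert (E : path_sum ell x z = path_sum ell x z / r * r) by (field; lra).
    set (l := path_sum ell x z / r) in *. rewrite E. destruct (Rle_dec _ _) as [h0|h0]; [left|right]; split; auto.
    - apply (Rmult_le_reg_r r); lra.
    - apply (Rmult_lt_reg_r r); lra. }
  split.
  - apply Rle_minus_l.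
    rewrite <- (Eseq_const d Q HQ n x (1 - G (eta / sqrt del)) Hx), <- Eseq_plus.
    apply Eseq_le; [exact HQ|exact Hx|]. intros z Hz Hq.
    destruct (Hcase z Hz Hq) as [[Hl ->]|[Hl ->]].
    + pose proof (G_upper ((path_sum ell x z / r - (c + eta)) / sqrt del)). lra.
    + rewrite Rplus_0_l, <- G_symmetric. apply G_monotone.
      unfold Rdiv. rewrite Ropp_mult_distr_l. apply Rmult_le_compat_r; [lra|]. unfold Rdiv in Hl. lra.
  - rewrite <- (Eseq_const d Q HQ n x (1 - G (eta / sqrt del)) Hx), <- Eseq_plus.
    apply Eseq_le; [exact HQ|exact Hx|]. intros z Hz Hq.
    destruct (Hcase z Hz Hq) as [[Hl ->]|[Hl ->]].
    + assert (G (eta / sqrt del) <= G ((path_sum ell x z / r - (c - eta)) / sqrt del)); [|lra].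
      apply G_monotone. apply Rmult_le_compat_r; lra.
    + pose proof (G_lower ((path_sum ell x z / r - (c - eta)) / sqrt del)). lra.
Qed.

Lemma tail_CLT x c : (x < d)%nat -> Un_cv (fun n => tail_prob n x c) (G (- c / sqrt s2)).
Proof.
  intros Hx theta Htheta.
  (* The argument of [G] in the limit of the smoothed problem when [del = eta^4]. The power is even,
     so [f eta] and [f (- eta)] treat both sides of the sandwich with the same [del]. *)
  set (f := fun eta => (eta - c) / sqrt (eta ^ 4 + s2)).
  assert (Hcont : continuity_pt f 0).
  { apply continuity_pt_filterlim, (ex_derive_continuous (V := R_NormedModule)).
    unfold f. auto_derive. repeat split; simpl.
    - replace (0 * (0 * (0 * (0 * 1))) + s2) with s2 by ring. exact Hs2.
    - apply Rgt_not_eq, sqrt_lt_R0. lra. }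
  destruct (Hcont (theta / 100)) as (rho & Hrho & Hc); [lra|].
  assert (Hf : forall eta, Rabs eta < rho -> Rabs (G (f eta) - G (- c / sqrt s2)) <= theta / 4).
  { intros eta Heta.
    assert (Hf0 : f 0 = - c / sqrt s2).
    { unfold f. replace (0 ^ 4 + s2) with s2 by ring. unfold Rdiv. ring. }
    rewrite <- Hf0. destruct (Req_dec eta 0) as [->|Hne].
    - rewrite Rminus_diag, Rabs_R0; lra.
    - eapply Rle_trans; [apply G_lipschitz|].
      assert (Rabs (f eta - f 0) < theta / 100); [|lra].
      apply Hc. split; [split; [exact I|now apply not_eq_sym]|].
      change (Rabs (eta - 0) < rho). now rewrite Rminus_0_r. }
  destruct (G_tends_to_1 (theta / 4)) as (X & HX & HGX); [lra|].
  (* [rho / 2] keeps both arguments near [f 0]. The bound [/ X] makes eta / sqrt del = 1/eta at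
     least [X], so the smoothing error is at most theta/4. *)
  set (eta := Rmin (rho / 2) (/ X)).
  assert (Heta : 0 < eta) by (apply Rmin_pos; [lra|now apply Rinv_0_lt_compat]).
  assert (Heta1 : eta <= rho / 2) by apply Rmin_l.
  assert (Heta2 : X <= / eta).
  { rewrite <- (Rinv_inv X). apply Rinv_le_contravar; [exact Heta|apply Rmin_r]. }
  set (del := eta ^ 4).
  assert (Hdel : 0 < del) by now apply pow_lt.
  assert (Hsd : eta / sqrt del = / eta).
  { unfold del. replace (eta ^ 4) with ((eta * eta) * (eta * eta)) by ring.
    rewrite sqrt_square by nra. field. lra. }
  destruct (smooth_CLT (c - eta) del x Hdel Hx) as (C1 & HC1).
  destruct (smooth_CLT (c + eta) del x Hdel Hx) as (C2 & HC2).
  destruct (div_sqrt_INR_small C1 (theta / 4)) as (N1 & HN1); [lra|].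
  destruct (div_sqrt_INR_small C2 (theta / 4)) as (N2 & HN2); [lra|].
  exists (N1 + N2)%nat. intros n Hn.
  destruct (HN1 n ltac:(lia)) as [Hn1 Hs1]. destruct (HN2 n ltac:(lia)) as [_ Hs2'].
  specialize (HC1 n Hn1). specialize (HC2 n Hn1).
  pose proof (tail_smooth_bounds n x c eta del Hn1 Hx Hdel Heta) as [Hlo Hhi].
  rewrite Hsd in Hlo, Hhi. specialize (HGX (/ eta) Heta2).
  assert (F1 : Rabs eta < rho) by (rewrite Rabs_pos_eq; lra).
  assert (F2 : Rabs (- eta) < rho) by (rewrite Rabs_Ropp, Rabs_pos_eq; lra).
  apply Hf in F1, F2. unfold f in F1, F2.
  replace ((- eta) ^ 4) with del in F2 by (unfold del; ring). fold del in F1.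
  replace (eta - c) with (- (c - eta)) in F1 by ring.
  replace (- eta - c) with (- (c + eta)) in F2 by ring.
  unfold R_dist. apply Rabs_le_between in HC1, HC2, F1, F2. apply Rabs_def1; lra.
Qed.
End CLT.

(** * Coding bounds *)

Lemma sumR_seq_injective d (f : nat -> nat) F :
  (forall a, (a < d)%nat -> (f a < d)%nat) ->
  (forall a b, (a < d)%nat -> (b < d)%nat -> f a = f b -> a = b) ->
  sumR (seq 0 d) (fun a => F (f a)) = sumR (seq 0 d) F.
Proof.
  intros Hf Hinj. rewrite <- (sumR_map (seq 0 d) f F). apply sumR_perm.
  apply NoDup_Permutation_bis.
  - apply NoDup_map_NoDup_ForallPairs; [|apply seq_NoDup].
    intros a b Ha Hb. apply in_seq0 in Ha, Hb. auto.
  - now rewrite length_map.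
  - intros y Hy. apply in_map_iff in Hy. destruct Hy as (a & <- & Ha).
    apply in_seq0 in Ha. apply in_seq0. auto.
Qed.

Lemma mod_sub d a b : (a < d)%nat -> (b < d)%nat ->
  ((a + d - b) mod d = if lt_dec a b then a + d - b else a - b)%nat.
Proof.
  intros Ha Hb. destruct (lt_dec a b).
  - apply Nat.mod_small. lia.
  - replace (a + d - b)%nat with (a - b + 1 * d)%nat by lia.
    rewrite Nat.Div0.mod_add. apply Nat.mod_small. lia.
Qed.

Lemma sumR_zsub_left d n x F : valid d n x ->
  sumR (all_seqs d n) (fun y => F (zsub d y x)) = sumR (all_seqs d n) F.
Proof.
  intros [Hl Hf]. subst n. revert F. induction Hf as [|b x Hb Hf IH]; intros F; [reflexivity|].
  simpl. rewrite !sumR_flat_map.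
  rewrite (sumR_ext _ _ (fun a => sumR (all_seqs d (length x)) (fun z => F (((a + d - b) mod d)%nat :: z)))).
  - rewrite (sumR_seq_injective d (fun a => ((a + d - b) mod d)%nat)
       (fun a => sumR (all_seqs d (length x)) (fun z => F (a :: z)))).
    + apply sumR_ext. intros a _. now rewrite sumR_map.
    + intros a Ha. apply Nat.mod_upper_bound. lia.
    + intros a a' Ha Ha'. rewrite !mod_sub by assumption.
      destruct (lt_dec a b), (lt_dec a' b); lia.
  - intros a _. rewrite sumR_map. apply (IH (fun z => F (((a + d - b) mod d)%nat :: z))).
Qed.

(** For a fixed output, the map from input to noise is a bijection, so the channel matrix also sums
    to 1 over inputs. The averaging in the greedy construction rests on this. *)
Lemma sumR_zsub_right d n y F : valid d n y ->
  sumR (all_seqs d n) (fun x => F (zsub d y x)) = sumR (all_seqs d n) F.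
Proof.
  intros [Hl Hf]. subst n. revert F. induction Hf as [|a y Ha Hf IH]; intros F; [reflexivity|].
  simpl. rewrite !sumR_flat_map.
  rewrite (sumR_ext _ _ (fun b => sumR (all_seqs d (length y)) (fun z => F (((a + d - b) mod d)%nat :: z)))).
  - rewrite (sumR_seq_injective d (fun b => ((a + d - b) mod d)%nat)
       (fun a => sumR (all_seqs d (length y)) (fun z => F (a :: z)))).
    + apply sumR_ext. intros b _. now rewrite sumR_map.
    + intros b Hb. apply Nat.mod_upper_bound. lia.
    + intros b b' Hb Hb'. rewrite !mod_sub by assumption.
      destruct (lt_dec a b), (lt_dec a b'); lia.
  - intros b _. rewrite sumR_map. apply (IH (fun z => F (((a + d - b) mod d)%nat :: z))).
Qed.

Lemma zsub_valid d n y x : valid d n y -> valid d n x -> valid d n (zsub d y x).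
Proof.
  intros [Hy Fy] [Hx Fx]. split.
  - unfold zsub. rewrite length_map, length_combine. lia.
  - unfold zsub. apply Forall_map. apply Forall_forall. intros [a b] Hab. simpl.
    apply in_combine_l in Hab. rewrite Forall_forall in Fy. specialize (Fy a Hab).
    apply Nat.mod_upper_bound. lia.
Qed.

Lemma length_all_seqs d n : INR (length (all_seqs d n)) = INR d ^ n.
Proof.
  induction n as [|n IH]; [reflexivity|]. simpl all_seqs.
  rewrite <- (Rmult_1_r (INR (length _))), <- (sumR_const _ 1), sumR_flat_map.
  rewrite (sumR_ext _ _ (fun _ => INR d ^ n)).
  - rewrite sumR_const, length_seq. simpl. ring.
  - intros a _. rewrite sumR_map, sumR_const, IH. ring.
Qed.

Lemma sumR_indicator_disjoint N (p : nat -> bool) :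
  (forall i j, (i < N)%nat -> (j < N)%nat -> i <> j -> p i = true -> p j = true -> False) ->
  sumR (seq 0 N) (fun i => if p i then 1 else 0) <= 1.
Proof.
  induction N as [|N IH]; intros Hdis; [simpl; lra|]. rewrite sumR_seq_S.
  destruct (p N) eqn:HN.
  - rewrite sumR_zero; [lra|]. intros i Hi. apply in_seq0 in Hi.
    destruct (p i) eqn:Hpi; [|reflexivity]. exfalso. apply (Hdis i N); auto; lia.
  - assert (sumR (seq 0 N) (fun i => if p i then 1 else 0) <= 1); [|lra].
    apply IH. intros i j Hi Hj. apply Hdis; lia.
Qed.

Section Coding.
Variables (d n : nat) (Q : nat -> nat -> R) (s0 : nat).
Hypothesis (HQ : stochastic d Q).
Hypothesis (Hs0 : (s0 < d)%nat).

Definition prob_le (T : R) : R := Eseq d Q n s0 (fun z => if Rle_dec (Qseq Q s0 z) T then 1 else 0).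

Let q := Qseq Q s0.

Lemma Wch_nonneg x y : valid d n x -> valid d n y -> 0 <= Wch d Q s0 y x.
Proof. intros Hx Hy. apply (Qseq_nonneg d Q HQ n); [exact Hs0|now apply zsub_valid]. Qed.

Lemma sumR_Qseq : sumR (all_seqs d n) q = 1.
Proof.
  rewrite <- (Eseq_one d Q HQ n s0 Hs0). apply sumR_ext. intros; unfold q; ring.
Qed.

Lemma success_bounds (D : list nat -> bool) x : valid d n x ->
  0 <= sumR (all_seqs d n) (fun y => if D y then Wch d Q s0 y x else 0) <= 1.
Proof.
  intros Hx. split.
  - apply sumR_nonneg. intros y Hy. apply all_seqs_valid in Hy.
    pose proof (Wch_nonneg x y Hx Hy). destruct (D y); lra.
  - rewrite <- sumR_Qseq, <- (sumR_zsub_left d n x q Hx). apply sumR_le.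
    intros y Hy. apply all_seqs_valid in Hy. pose proof (Wch_nonneg x y Hx Hy) as Hw.
    unfold Wch in *. fold q in Hw |- *. destruct (D y); lra.
Qed.

Lemma Pe_bounds c : is_code d n c -> 0 <= Pe d n Q s0 c <= 1.
Proof.
  intros (HN & Hv & _). unfold Pe.
  assert (HN' : 0 < INR (csize c)) by (apply lt_0_INR; lia).
  assert (Hi : 0 < / INR (csize c)) by now apply Rinv_0_lt_compat.
  split.
  - apply Rmult_le_pos; [lra|]. apply sumR_nonneg. intros i Hin. apply in_seq0 in Hin.
    pose proof (success_bounds (cdec c i) _ (Hv i Hin)). lra.
  - apply (Rmult_le_reg_l (INR (csize c))); [exact HN'|].
    rewrite <- Rmult_assoc, Rinv_r, Rmult_1_l by lra.
    replace (INR (csize c) * 1) with (sumR (seq 0 (csize c)) (fun _ => 1))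
      by (rewrite sumR_const, length_seq; ring).
    apply sumR_seq_le. intros i Hin.
    pose proof (success_bounds (cdec c i) _ (Hv i Hin)). lra.
Qed.

Lemma prob_le_complement T :
  prob_le T = 1 - sumR (all_seqs d n) (fun z => if Rle_dec (q z) T then 0 else q z).
Proof.
  rewrite <- sumR_Qseq, <- sumR_minus. apply sumR_ext. intros z _. unfold q.
  destruct (Rle_dec _ _); ring.
Qed.

(** On a decoding set, outputs whose noise has probability above [T] contribute at most
    [1 - prob_le T], and the others at most [T] per point. Disjointness bounds the total number of
    points by d^n. *)
Lemma code_error_lower c T : is_code d n c -> 0 < T ->
  prob_le T - T * INR d ^ n / INR (csize c) <= Pe d n Q s0 c.
Proof.
  intros (HN & Hv & Hdis) HT.
  assert (HN' : 0 < INR (csize c)) by (apply lt_0_INR; lia).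
  unfold Pe. apply (Rmult_le_reg_l (INR (csize c))); [exact HN'|].
  rewrite <- Rmult_assoc, Rinv_r, Rmult_1_l by lra.
  replace (INR (csize c) * (prob_le T - T * INR d ^ n / INR (csize c)))
    with (INR (csize c) * prob_le T - T * INR d ^ n) by (field; lra).
  apply Rle_trans with (sumR (seq 0 (csize c)) (fun i =>
     prob_le T - T * sumR (all_seqs d n) (fun y => if cdec c i y then 1 else 0))).
  - rewrite sumR_minus, sumR_const, length_seq, sumR_scal, sumR_swap.
    assert (sumR (all_seqs d n) (fun y => sumR (seq 0 (csize c)) (fun i => if cdec c i y then 1 else 0))
      <= INR d ^ n).
    { rewrite <- length_all_seqs, <- (Rmult_1_r (INR _)), <- sumR_const. apply sumR_le.
      intros y _. apply sumR_indicator_disjoint. intros i j Hi Hj Hij. now apply Hdis. }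
    assert (T * sumR (all_seqs d n) (fun y => sumR (seq 0 (csize c)) (fun i => if cdec c i y then 1 else 0))
      <= T * INR d ^ n) by (apply Rmult_le_compat_l; lra).
    lra.
  - apply sumR_seq_le. intros i Hi. rewrite prob_le_complement.
    rewrite <- (sumR_zsub_left d n (cenc c i) (fun z => if Rle_dec (q z) T then 0 else q z) (Hv i Hi)).
    assert (sumR (all_seqs d n) (fun y => if cdec c i y then Wch d Q s0 y (cenc c i) else 0)
      <= sumR (all_seqs d n) (fun y => (if Rle_dec (q (zsub d y (cenc c i))) T then 0 else q (zsub d y (cenc c i)))
          + T * (if cdec c i y then 1 else 0))).
    { apply sumR_le. intros y Hy. apply all_seqs_valid in Hy.
      pose proof (Wch_nonneg _ _ (Hv i Hi) Hy) as Hw. unfold Wch in *. fold q in Hw |- *.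
      destruct (cdec c i y), (Rle_dec _ _); lra. }
    rewrite sumR_plus, sumR_scal in H. lra.
Qed.

(* Greedy (Feinstein) construction: averaging over all shifts [x], the already occupied set [U] has
   probability [|U| / d^n] under the channel, so some [x] is at least that good. *)
Lemma greedy_code T N : 0 < T ->
  exists (enc : nat -> list nat) (dec : nat -> list nat -> bool) (U : list nat -> bool),
    (forall i, (i < N)%nat -> valid d n (enc i)) /\
    (forall i j y, (i < N)%nat -> (j < N)%nat -> i <> j -> dec i y = true -> dec j y = true -> False) /\
    (forall i y, (i < N)%nat -> dec i y = true -> U y = true) /\
    sumR (all_seqs d n) (fun y => if U y then 1 else 0) <= INR N / T /\
    (forall i, (i < N)%nat ->
       1 - sumR (all_seqs d n) (fun y => if dec i y then Wch d Q s0 y (enc i) else 0)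
       <= prob_le T + INR (N - 1) / (T * INR d ^ n)).
Proof.
  intros HT.
  assert (Hdn : 0 < INR d ^ n) by (apply pow_lt, lt_0_INR; lia).
  assert (HTi : 0 < / T) by now apply Rinv_0_lt_compat.
  assert (HTdi : 0 < / (T * INR d ^ n)) by (apply Rinv_0_lt_compat, Rmult_lt_0_compat; assumption).
  induction N as [|N IH].
  - exists (fun _ => nil), (fun _ _ => false), (fun _ => false).
    repeat split; try (intros; lia).
    rewrite sumR_zero by reflexivity. simpl. lra.
  - destruct IH as (enc & dec & U & Hv & Hdis & HU & Hcard & Herr).
    destruct (sumR_exists_le_average (all_seqs d n)
       (fun x => sumR (all_seqs d n) (fun y => if U y then Wch d Q s0 y x else 0))
       (INR N / (T * INR d ^ n))) as (x & Hx & Hxle).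
    { intros E. apply (f_equal (@length _)) in E. apply (f_equal INR) in E.
      rewrite length_all_seqs in E. simpl in E. lra. }
    { rewrite sumR_swap, length_all_seqs.
      replace (INR d ^ n * (INR N / (T * INR d ^ n))) with (INR N / T) by (field; lra).
      eapply Rle_trans; [|exact Hcard]. right. apply sumR_ext. intros y Hy. apply all_seqs_valid in Hy.
      destruct (U y).
      - rewrite <- sumR_Qseq. apply (sumR_zsub_right d n y q Hy).
      - now apply sumR_zero. }
    apply all_seqs_valid in Hx.
    (* [A] is the shift to [x] of the likely noise; the new decoding set is [A] minus the occupied
       set [U]. *)
    set (A := fun y => if Rle_dec (q (zsub d y x)) T then false else true).
    exists (fun i => if Nat.eq_dec i N then x else enc i),
      (fun i y => if Nat.eq_dec i N then A y && negb (U y) else dec i y)%bool,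
      (fun y => U y || A y)%bool.
    split; [|split; [|split; [|split]]].
    + intros i Hi. destruct (Nat.eq_dec i N); [exact Hx|apply Hv; lia].
    + intros i j y Hi Hj Hij.
      assert (Hc : forall k, (k < S N)%nat -> k <> N -> dec k y = true -> U y = true)
        by (intros k Hk HkN; apply HU; lia).
      destruct (Nat.eq_dec i N), (Nat.eq_dec j N); subst; try lia.
      * intros E1 E2. rewrite (Hc j Hj) in E1 by auto. rewrite Bool.andb_false_r in E1. discriminate.
      * intros E1 E2. rewrite (Hc i Hi) in E2 by auto. rewrite Bool.andb_false_r in E2. discriminate.
      * apply Hdis; lia.
    + intros i y Hi. destruct (Nat.eq_dec i N).
      * destruct (A y); [now rewrite Bool.orb_true_r|discriminate].
      * intros E. rewrite (HU i y) by (auto; lia). reflexivity.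
    (* Points of [A] have probability above [T], so the indicator of [A] is at most that probability
       over [T]: [U] grows by at most [1 / T] points. *)
    + apply Rle_trans with (sumR (all_seqs d n) (fun y => (if U y then 1 else 0)
          + / T * (if Rle_dec (q (zsub d y x)) T then 0 else q (zsub d y x)))).
      * apply sumR_le. intros y Hy. apply all_seqs_valid in Hy.
        pose proof (Wch_nonneg x y Hx Hy) as Hw. unfold Wch in Hw. fold q in Hw.
        unfold A. destruct (Rle_dec _ _) as [|Hgt]; destruct (U y); simpl; try lra.
        -- assert (0 <= / T * q (zsub d y x)) by (apply Rmult_le_pos; lra). lra.
        -- assert (/ T * T <= / T * q (zsub d y x)) by (apply Rmult_le_compat_l; lra).
           rewrite Rinv_l in H by lra. lra.
      * rewrite sumR_plus, sumR_scal,
          (sumR_zsub_left d n x (fun z => if Rle_dec (q z) T then 0 else q z) Hx), S_INR.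
        assert (sumR (all_seqs d n) (fun z => if Rle_dec (q z) T then 0 else q z) <= 1).
        { rewrite <- sumR_Qseq. apply sumR_le. intros z Hz. apply all_seqs_valid in Hz.
          pose proof (Qseq_nonneg d Q HQ n s0 z Hs0 Hz). unfold q. destruct (Rle_dec _ _); lra. }
        assert (/ T * sumR (all_seqs d n) (fun z => if Rle_dec (q z) T then 0 else q z) <= / T * 1)
          by (apply Rmult_le_compat_l; lra).
        unfold Rdiv in *. lra.
    (* For the new word, success is at least the probability of [A] minus that of [U], the latter at
       most N / (T d^n). Earlier words keep a bound that only grows with N. *)
    + intros i Hi. replace (S N - 1)%nat with N by lia. destruct (Nat.eq_dec i N) as [->|Hne].
      * assert (Hs : sumR (all_seqs d n) (fun y =>
             (if Rle_dec (q (zsub d y x)) T then 0 else q (zsub d y x))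
             - (if U y then Wch d Q s0 y x else 0))
           <= sumR (all_seqs d n) (fun y => if (A y && negb (U y))%bool then Wch d Q s0 y x else 0)).
        { apply sumR_le. intros y Hy. apply all_seqs_valid in Hy.
          pose proof (Wch_nonneg x y Hx Hy) as Hw. unfold Wch in *. fold q in Hw |- *.
          unfold A. destruct (Rle_dec _ _), (U y); simpl; lra. }
        rewrite sumR_minus,
          (sumR_zsub_left d n x (fun z => if Rle_dec (q z) T then 0 else q z) Hx) in Hs.
        rewrite prob_le_complement. lra.
      * eapply Rle_trans; [apply Herr; lia|]. apply Rplus_le_compat_l.
        apply Rmult_le_compat_r; [lra|]. apply le_INR. lia.
Qed.

Lemma code_exists T N : 0 < T -> (1 <= N)%nat ->
  exists c, is_code d n c /\ csize c = N /\
    Pe d n Q s0 c <= prob_le T + INR (N - 1) / (T * INR d ^ n).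
Proof.
  intros HT HN. destruct (greedy_code T N HT) as (enc & dec & U & Hv & Hdis & _ & _ & Herr).
  exists (mkCode N enc dec). split; [|split; [reflexivity|]].
  - split; [exact HN|]. split; assumption.
  - unfold Pe. cbn [csize cenc cdec].
    assert (HN' : 0 < INR N) by (apply lt_0_INR; lia).
    apply (Rmult_le_reg_l (INR N)); [exact HN'|].
    rewrite <- Rmult_assoc, Rinv_r, Rmult_1_l by lra.
    match goal with |- _ <= _ * ?e => replace (INR N * e) with (sumR (seq 0 N) (fun _ => e))
      by (rewrite sumR_const, length_seq; ring) end.
    now apply sumR_seq_le.
Qed.
End Coding.

(** Both sides are used: [x <= INR N] gives the rate, and [INR (N - 1) <= x] matches the [N - 1] of
    the greedy error bound. *)
Lemma nat_ceiling x : 0 < x -> exists N, (1 <= N)%nat /\ INR (N - 1) <= x <= INR N.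
Proof.
  intros Hx. destruct (archimed x) as [H1 H2].
  assert (Hz : (0 < up x)%Z) by (apply lt_IZR; lra).
  exists (Z.to_nat (up x)).
  assert (HN : INR (Z.to_nat (up x)) = IZR (up x)) by (rewrite INR_IZR_INZ, Z2Nat.id; [reflexivity|lia]).
  assert (1 <= Z.to_nat (up x))%nat by lia.
  rewrite minus_INR, HN by assumption. simpl. split; [assumption|]. lra.
Qed.

Lemma exp_neg_sqrt_small eta eps : 0 < eta -> 0 < eps ->
  exists N, forall n, (N <= n)%nat -> exp (- (eta * sqrt (INR n))) < eps.
Proof.
  intros Heta He. destruct (div_sqrt_INR_small (/ eta) eps He) as (N & HN).
  exists N. intros n Hn. destruct (HN n Hn) as [Hn1 Hlt]. eapply Rle_lt_trans; [|exact Hlt].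
  assert (0 < sqrt (INR n)) by (apply sqrt_lt_R0, lt_0_INR; lia).
  unfold Rdiv. rewrite <- Rinv_mult, exp_Ropp. pose proof (exp_ineq1_le (eta * sqrt (INR n))).
  assert (0 < eta * sqrt (INR n)) by (apply Rmult_lt_0_compat; assumption).
  apply Rinv_le_contravar; lra.
Qed.

(** Code sequences in [CpSet] and [CSet] must exhibit a real limsup; error probabilities lie in
    [0, 1], which excludes infinite ones. *)
Lemma is_limsup_exists u : (forall n, 0 <= u n <= 1) -> exists L, is_limsup u L.
Proof.
  intros Hu. destruct (ex_LimSup_seq u) as ([L| |] & HL); simpl in HL.
  - exists L. intros eps He. destruct (HL (mkposreal eps He)) as (H1 & N & H2). simpl in *. split.
    + exists N. intros n Hn. specialize (H2 n Hn). lra.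
    + intros N'. destruct (H1 N') as (n & Hn & H). exists n. split; [exact Hn|lra].
  - destruct (HL 1 0%nat) as (n & _ & H). specialize (Hu n). lra.
  - destruct (HL 0) as (N & H). specialize (H N (le_n N)). specialize (Hu N). lra.
Qed.

(** * From the tail limit to both second-order formulas *)

Section SecondOrder.
Variables (d : nat) (Q : nat -> nat -> R) (s0 : nat) (P : nat -> R) (V : R).
Hypothesis (Hst : stochastic d Q) (Hs0 : (s0 < d)%nat) (HV : 0 < V).
Let H := HQ d Q P.
Hypothesis Htail : forall c, Un_cv (fun n => tail_prob d Q H n s0 c) (G (- c / sqrt V)).

(** Taking logarithms identifies the two events on sequences of positive probability; both
    inequalities are non-strict, so the equality is exact. *)
Lemma prob_le_tail n c : prob_le d n Q s0 (exp (- (INR n * H + c * sqrt (INR n)))) = tail_prob d Q H n s0 c.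
Proof.
  apply (Eseq_ext d Q Hst n s0 _ _ Hs0). intros z _ Hq.
  assert (E : Qseq Q s0 z = exp (ln (Qseq Q s0 z))) by (rewrite exp_ln; auto).
  destruct (Rle_dec (Qseq Q s0 z) _) as [h1|h1], (Rle_dec (c * sqrt (INR n)) _) as [h2|h2]; try reflexivity; exfalso.
  - rewrite E in h1. apply h2.
    destruct (Rle_dec (ln (Qseq Q s0 z)) (- (INR n * H + c * sqrt (INR n)))) as [|h3]; [lra|].
    apply Rnot_le_lt, exp_increasing in h3. lra.
  - apply h1. rewrite E. destruct (Rle_lt_or_eq_dec (ln (Qseq Q s0 z)) (- (INR n * H + c * sqrt (INR n)))) as [h3|h3].
    + lra.
    + left. now apply exp_increasing.
    + right. now f_equal.
Qed.

Lemma pow_d_exp n : INR d ^ n = exp (INR n * ln (INR d)).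
Proof.
  rewrite <- Rpower_pow by (apply lt_0_INR; lia). reflexivity.
Qed.

Lemma converse_bound n c a : (1 <= n)%nat -> is_code d n c -> forall eta,
  a - eta <= rate d n Q P c ->
  tail_prob d Q H n s0 (2 * eta - a) - exp (- (eta * sqrt (INR n))) <= Pe d n Q s0 c.
Proof.
  intros Hn Hc eta Hr.
  assert (Hs : 0 < sqrt (INR n)) by (apply sqrt_lt_R0, lt_0_INR; lia).
  assert (HN : 0 < INR (csize c)) by (apply lt_0_INR; destruct Hc; lia).
  (* One [eta] is the slack in the rate; the second leaves the counting term T d^n / N at most exp
     (- eta sqrt n). *)
  set (T := exp (- (INR n * H + (2 * eta - a) * sqrt (INR n)))).
  eapply Rle_trans; [|apply (code_error_lower d n Q s0 Hst Hs0 c T Hc (exp_pos _))].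
  unfold T at 1. rewrite prob_le_tail.
  assert (T * INR d ^ n / INR (csize c) <= exp (- (eta * sqrt (INR n)))); [|lra].
  unfold T. rewrite pow_d_exp. rewrite <- (exp_ln (INR (csize c))) by exact HN.
  unfold Rdiv. rewrite <- exp_Ropp, <- !exp_plus.
  unfold rate in Hr. apply (Rmult_le_compat_r (sqrt (INR n))) in Hr; [|lra].
  replace ((ln (INR (csize c)) - INR n * CAM d Q P) / sqrt (INR n) * sqrt (INR n))
    with (ln (INR (csize c)) - INR n * CAM d Q P) in Hr by (field; lra).
  unfold CAM in Hr. fold H in Hr.
  match goal with |- exp ?u <= exp ?v => assert (Huv : u <= v) by lra; destruct Huv as [Huv| ->]; [left; now apply exp_increasing|lra] end.
Qed.

Lemma converse a cs L : (forall n, is_code d n (cs n)) ->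
  liminf_ge (fun n => rate d n Q P (cs n)) a -> is_limsup (fun n => Pe d n Q s0 (cs n)) L ->
  G (a / sqrt V) <= L.
Proof.
  intros Hc Hr HL. apply le_epsilon. intros theta Htheta.
  pose proof (sqrt_lt_R0 V HV) as HsV.
  (* The shift 2 eta / sqrt V is then theta/100, and the Lipschitz constant 17 keeps its effect on
     [G] below theta/4. *)
  set (eta := theta * sqrt V / 200).
  assert (Heta : 0 < eta) by (unfold eta, Rdiv; repeat apply Rmult_lt_0_compat; lra).
  destruct (Hr eta Heta) as (N1 & HN1).
  destruct (HL (theta / 4)) as [(N2 & HN2) _]; [lra|].
  destruct (Htail (2 * eta - a) (theta / 4)) as (N3 & HN3); [lra|].
  destruct (exp_neg_sqrt_small eta (theta / 4) Heta) as (N4 & HN4); [lra|].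
  set (n := (1 + N1 + N2 + N3 + N4)%nat).
  specialize (HN1 n ltac:(lia)). specialize (HN2 n ltac:(lia)).
  specialize (HN3 n ltac:(lia)). specialize (HN4 n ltac:(lia)). cbv beta in HN1, HN2.
  pose proof (converse_bound n (cs n) a ltac:(lia) (Hc n) eta HN1) as Hb.
  apply Rabs_def2 in HN3.
  pose proof (G_lipschitz (- (2 * eta - a) / sqrt V) (a / sqrt V)) as Hlip.
  replace (a / sqrt V - - (2 * eta - a) / sqrt V) with (theta / 100) in Hlip
    by (unfold eta; field; lra).
  rewrite (Rabs_pos_eq (theta / 100)) in Hlip by lra.
  apply Rabs_le_between in Hlip. lra.
Qed.

Lemma achievability_bound n a eta :
  exists c, is_code d n c /\ exp (INR n * CAM d Q P + a * sqrt (INR n)) <= INR (csize c) /\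
    Pe d n Q s0 c <= tail_prob d Q H n s0 (- (a + eta)) + exp (- (eta * sqrt (INR n))).
Proof.
  destruct (nat_ceiling (exp (INR n * CAM d Q P + a * sqrt (INR n)))) as (N & HN1 & HN2 & HN3); [apply exp_pos|].
  (* Then T d^n = exp (n C + (a + eta) sqrt n), with C = [CAM d Q P], exceeds [N - 1] by a factor of
     at least exp (eta sqrt n). *)
  set (T := exp (- (INR n * H + (- (a + eta)) * sqrt (INR n)))).
  destruct (code_exists d n Q s0 Hst Hs0 T N (exp_pos _) HN1) as (c & Hc & HcN & HPe).
  exists c. rewrite HcN. split; [exact Hc|]. split; [exact HN3|].
  eapply Rle_trans; [exact HPe|]. unfold T at 1. rewrite prob_le_tail. apply Rplus_le_compat_l.
  eapply Rle_trans.
  - apply Rmult_le_compat_r; [|exact HN2]. left. apply Rinv_0_lt_compat, Rmult_lt_0_compat; [apply exp_pos|].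
    apply pow_lt, lt_0_INR. lia.
  - unfold T. rewrite pow_d_exp, <- exp_plus, <- exp_Ropp, <- exp_plus. right. f_equal.
    unfold CAM. fold H. ring.
Qed.

Lemma achievability a theta : 0 < theta ->
  exists cs L, (forall n, is_code d n (cs n)) /\ liminf_ge (fun n => rate d n Q P (cs n)) a /\
    is_limsup (fun n => Pe d n Q s0 (cs n)) L /\ L <= G (a / sqrt V) + theta.
Proof.
  intros Htheta. pose proof (sqrt_lt_R0 V HV) as HsV.
  set (eta := theta * sqrt V / 200).
  assert (Heta : 0 < eta) by (unfold eta, Rdiv; repeat apply Rmult_lt_0_compat; lra).
  set (cs := fun n => proj1_sig (constructive_indefinite_description _ (achievability_bound n a eta))).
  assert (Hcs : forall n, is_code d n (cs n) /\ exp (INR n * CAM d Q P + a * sqrt (INR n)) <= INR (csize (cs n)) /\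
    Pe d n Q s0 (cs n) <= tail_prob d Q H n s0 (- (a + eta)) + exp (- (eta * sqrt (INR n)))).
  { intros n. unfold cs. apply proj2_sig. }
  clearbody cs.
  destruct (is_limsup_exists (fun n => Pe d n Q s0 (cs n))) as (L & HL).
  { intros n. apply Pe_bounds; auto. apply Hcs. }
  exists cs, L. split; [apply Hcs|]. split; [|split; [exact HL|]].
  - intros eps He. exists 1%nat. intros n Hn. destruct (Hcs n) as (_ & Hsize & _).
    assert (Hs : 0 < sqrt (INR n)) by (apply sqrt_lt_R0, lt_0_INR; lia).
    apply Rle_trans with a; [lra|]. unfold rate.
    apply (Rmult_le_reg_r (sqrt (INR n))); [exact Hs|].
    replace ((ln (INR (csize (cs n))) - INR n * CAM d Q P) / sqrt (INR n) * sqrt (INR n))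
      with (ln (INR (csize (cs n))) - INR n * CAM d Q P) by (field; lra).
    assert (Hln : INR n * CAM d Q P + a * sqrt (INR n) <= ln (INR (csize (cs n)))); [|lra].
    rewrite <- (ln_exp (INR n * CAM d Q P + a * sqrt (INR n))). apply ln_le; [apply exp_pos|exact Hsize].
  - destruct (HL (theta / 4)) as [_ Hinf]; [lra|].
    destruct (Htail (- (a + eta)) (theta / 4)) as (N1 & HN1); [lra|].
    destruct (exp_neg_sqrt_small eta (theta / 4) Heta) as (N2 & HN2); [lra|].
    destruct (Hinf (N1 + N2)%nat) as (n & Hn & HLn).
    specialize (HN1 n ltac:(lia)). specialize (HN2 n ltac:(lia)).
    destruct (Hcs n) as (_ & _ & HPe). apply Rabs_def2 in HN1.
    pose proof (G_lipschitz (a / sqrt V) (- - (a + eta) / sqrt V)) as Hlip.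
    replace (- - (a + eta) / sqrt V - a / sqrt V) with (theta / 200) in Hlip
      by (unfold eta; field; lra).
    rewrite (Rabs_pos_eq (theta / 200)) in Hlip by lra.
    apply Rabs_le_between in Hlip. lra.
Qed.

Lemma Ginv_spec eps : 0 < eps < 1 -> G (Ginv eps) = eps.
Proof.
  intros He. unfold Ginv. apply epsilon_spec.
  destruct (G_tends_to_1 (eps / 2)) as (X & HX & HGX); [lra|].
  destruct (G_tends_to_1 ((1 - eps) / 2)) as (Y & HY & HGY); [lra|].
  assert (HGl : G (- X) < eps) by (rewrite G_symmetric; specialize (HGX X (Rle_refl X)); lra).
  assert (HGr : eps < G Y) by (specialize (HGY Y (Rle_refl Y)); lra).
  destruct (IVT_gen G (- X) Y eps) as (x & _ & Hx).
  - intros x. apply continuity_pt_filterlim, (ex_derive_continuous (V := R_NormedModule)).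
    eexists; apply G_derive.
  - unfold Rmin, Rmax. destruct (Rle_dec _ _); lra.
  - now exists x.
Qed.

Lemma second_order_theorem :
  (forall a, is_inf (CpSet d Q s0 P a) (G (a / sqrt V))) /\
  (forall eps, 0 < eps < 1 -> is_lub (CSet d Q s0 P eps) (sqrt V * Ginv eps)).
Proof.
  pose proof (sqrt_lt_R0 V HV) as HsV. split.
  - intros a. split.
    + intros r (cs & Hc & Hr & HL). exact (converse a cs r Hc Hr HL).
    + intros m Hm. apply le_epsilon. intros theta Htheta.
      destruct (achievability a theta Htheta) as (cs & L & Hc & Hr & HL & HLle).
      apply Rle_trans with L; [|exact HLle]. apply Hm. now exists cs.
  - intros eps He. pose proof (Ginv_spec eps He) as HG. split.
    + intros r (cs & Hc & (L & HL & HLe) & Hr).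
      pose proof (converse r cs L Hc Hr HL) as Hle.
      destruct (Rle_dec r (sqrt V * Ginv eps)) as [|h]; [assumption|]. exfalso.
      assert (Hlt : Ginv eps < r / sqrt V).
      { apply (Rmult_lt_reg_r (sqrt V)); [exact HsV|].
        replace (r / sqrt V * sqrt V) with r by (field; lra). lra. }
      apply G_increasing in Hlt. lra.
    + intros b Hb. apply le_epsilon. intros theta Htheta.
      (* Strict monotonicity of [G] leaves a positive gap [eps - G (r / sqrt V)], spent as the error
         slack of [achievability]. *)
      set (r := sqrt V * Ginv eps - theta).
      assert (Hlt : r / sqrt V < Ginv eps).
      { apply (Rmult_lt_reg_r (sqrt V)); [exact HsV|].
        replace (r / sqrt V * sqrt V) with r by (field; lra). unfold r. lra. }
      apply G_increasing in Hlt. rewrite HG in Hlt.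
      destruct (achievability r (eps - G (r / sqrt V))) as (cs & L & Hc & Hr & HL & HLle); [lra|].
      assert (r <= b); [|unfold r in *; lra].
      apply Hb. exists cs. split; [exact Hc|]. split; [|exact Hr]. exists L. split; [exact HL|lra].
Qed.
End SecondOrder.

Theorem theorem11 (d : nat) (Q : nat -> nat -> R) (s0 : nat) (P : nat -> R) (V : R)
  (Hd : (1 <= d)%nat)
  (HQ : stochastic d Q) (Hirr : irreducible d Q)
  (Hs0 : (s0 < d)%nat)
  (HP : stationary d Q P)
  (HV : Un_cv (fun n => varLL d n Q s0 / INR n) V)
  (HVpos : 0 < V) :
  (forall a : R, is_inf (CpSet d Q s0 P a) (G (a / sqrt V))) /\
  (forall eps : R, 0 < eps < 1 -> is_lub (CSet d Q s0 P eps) (sqrt V * Ginv eps)).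
Proof.
  apply second_order_theorem; [exact HQ|exact Hs0|exact HVpos|].
  set (H := Defs.HQ d Q P).
  set (ell := infdev Q H).
  destruct HP as (HP0 & HP1 & HPs).
  destruct (poisson_equation d Q HQ P (fun x => sumR (seq 0 d) (fun y => Q y x * ell x y)) Hd Hirr)
    as (h & Hh).
  { split; [|split]; assumption. }
  (* Under [P] the mean of [- ln Q] is the entropy rate, so the centred density has mean 0; where
     [Q y x = 0], the weighted logarithm agrees with [ent]. *)
  { rewrite (sumR_seq_ext _ _ (fun x => P x * sumR (seq 0 d) (fun y => ent (Q y x)) - P x * H)).
    - rewrite sumR_minus, sumR_scal_r, HP1. unfold H, Defs.HQ. ring.
    - intros x Hx. rewrite <- Rmult_minus_distr_l. f_equal.
      rewrite (sumR_seq_ext _ _ (fun y => ent (Q y x) - Q y x * H)).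
      + rewrite sumR_minus, sumR_scal_r, (proj2 HQ x Hx). ring.
      + intros y Hy. unfold ell, infdev, ent. pose proof (proj1 HQ x y Hx Hy).
        destruct (Rle_dec (Q y x) 0); [|ring]. replace (Q y x) with 0 by lra. ring. }
  (* [b] is the second-order source left once [h] is known, and [s2 / 2] is its mean under [P];
     subtracting it makes the second Poisson equation solvable. *)
  set (b := fun x => sumR (seq 0 d) (fun y => Q y x * (ell x y * ell x y / 2 + h y * ell x y))).
  set (s2 := 2 * sumR (seq 0 d) (fun x => P x * b x)).
  destruct (poisson_equation d Q HQ P (fun x => b x - s2 / 2) Hd Hirr) as (w & Hw).
  { split; [|split]; assumption. }
  { rewrite (sumR_ext _ _ (fun x => P x * b x - P x * (s2 / 2))) by (intros; ring).
    rewrite sumR_minus, sumR_scal_r, HP1. unfold s2. field. }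
  assert (Hh' : forall x, (x < d)%nat -> sumR (seq 0 d) (fun y => Q y x * (ell x y + h y)) = h x).
  { intros x Hx. rewrite (Hh x Hx), <- sumR_plus. apply sumR_ext. intros; ring. }
  assert (Hw' : forall x, (x < d)%nat ->
    sumR (seq 0 d) (fun y => Q y x * (ell x y * ell x y / 2 + h y * ell x y + w y)) = w x + s2 / 2).
  { intros x Hx. rewrite (Hw x Hx).
    rewrite (sumR_ext _ _ (fun y => Q y x * (ell x y * ell x y / 2 + h y * ell x y) + Q y x * w y)) by (intros; ring).
    rewrite sumR_plus. unfold b. ring. }
  (* [V] is given only as a limit of normalised variances; [varLL_limit] computes that limit and
     uniqueness concludes. *)
  assert (E : V = s2).
  { eapply UL_sequence; [exact HV|]. exact (varLL_limit d Q HQ H s2 h w Hh' Hw' s0 Hs0). }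
  intros c. rewrite E in HVpos |- *. exact (tail_CLT d Q HQ H s2 h w HVpos Hh' Hw' s0 c Hs0).
Qed.
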